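(* Let $n\ge 3$. Fix an element $\tau\in N_{S_n}(C)$ whose cycle type is either $(m^{\frac{n-1}{m}},1)$ or $(m^{\frac{n-2}{m}},1,1)$ for some integer $m$. Suppose that $H\le S_n$ is a subgroup that avoids the following cycle types: (i) $(\ell^{n/\ell})$ for any divisor $\ell>1$ of $n$; (ii) $(4,2^{\frac{n-4}{2}})$ if $m$ is even; (iii) $(\ell^{\frac{n-2}{\ell}},2)$ for any divisor $\ell>1$ of $m$; (iv) $((2\ell)^{\frac{n-2}{2\ell}},2)$ for any divisor $\ell>1$ of $m$, if $m$ is odd. Let $\langle\tau\rangle$ act on $Y=C\backslash S_n/H$ by $\tau\cdot CgH=C\tau gH$, and let $Y(q)=\frac{1}{[n]_q}X(q)$ where $X(q)=\mathcal{H}(\mathbb{C}[x]^H;q)/\mathcal{H}(\mathbb{C}[x]^{S_n};q)$. Then $(Y,Y(q),\langle\tau\rangle)$ exhibits the cyclic sieving phenomenon.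
   Context: $S_n$ acts on $\{1,\dots,n\}$; $c=(1,2,\dots,n)$ and $C=\langle c\rangle$; $N_{S_n}(C)$ is the normalizer of $C$ in $S_n$. $\mathbb{C}[x]=\mathbb{C}[x_1,\dots,x_n]$, graded by degree, with $S_n$ (and hence any subgroup $H$) acting by permuting the variables; $\mathbb{C}[x]^H$ is the ring of $H$-invariants and $\mathcal{H}(W;q)=\sum_i\dim(W_i)q^i$ the Hilbert series. $[n]_q=1+q+\cdots+q^{n-1}$. The cycle type of a permutation is the partition of $n$ formed by its cycle lengths; exponent notation $(m^j,\dots)$ means $j$ parts equal to $m$. A subgroup $H$ avoids a cycle type $\mu$ if no element of $H$ has cycle type $\mu$ (conditions whose exponents are not nonnegative integers are vacuous). For a set $Y$ with an action of a cyclic group $\langle\tau\rangle$ of order $m$ and a polynomial $Y(q)$ with integer coefficients, $(Y,Y(q),\langle\tau\rangle)$ exhibits the cyclic sieving phenomenon if for every integer $b$, $|\{y\in Y:\tau^b(y)=y\}|=Y(\zeta^b)$ where $\zeta=e^{2\pi i/m}$. *)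

(* Defs.v *)
From HB Require Import structures.
From mathcomp Require Import all_boot all_order all_fingroup all_algebra.
From mathcomp Require Import reals trigo.
From mathcomp Require Import complex mpoly.

Set Implicit Arguments.
Unset Strict Implicit.
Unset Printing Implicit Defensive.

Import GRing.Theory.

Local Open Scope ring_scope.

(* The cycle (1, 2, ..., n), with the points numbered 0, ..., n - 1. *)
Definition long_cycle (n : nat) : 'S_n := perm (@ordS_inj n).

Definition has_cycle_type (n : nat) (mu : seq nat) (s : 'S_n) : bool :=
  perm_eq [seq #|pred_of_set A| | A <- enum (porbits s)] mu.

Definition avoids (n : nat) (H : {set 'S_n}) (mu : seq nat) : Prop :=
  forall s, s \in H -> ~~ has_cycle_type mu s.

Definition double_coset (gT : finGroupType) (A : {set gT}) (g : gT)
    (B : {set gT}) : {set gT} :=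
  (A * [set g] * B)%g.

Definition double_cosets (gT : finGroupType) (A B : {set gT}) :
    {set {set gT}} :=
  [set double_coset A g B | g in [set: gT]].

Definition lmul (gT : finGroupType) (X : {set gT}) (a : gT) : {set gT} :=
  ([set a] * X)%g.

Lemma lmul_is_action (gT : finGroupType) (t : gT) :
  is_action <[t]>%g (@lmul gT).
Proof.
split=> [g|X a b at_ bt_]; first exact: can_inj (lcosetK g).
by rewrite /lmul (centsP (cycle_abelian t) a at_ b bt_) lcosetM.
Qed.

(* Left translation of subsets by <[t]>.  When t normalizes A it sends AgB to
   A(tg)B, see lmul_act_double_coset.  MathComp actions are right actions,
   which makes no difference here because <[t]> is commutative. *)
Definition lmul_act (gT : finGroupType) (t : gT) : action <[t]>%g {set gT} :=
  Action (@lmul_is_action gT t).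

Lemma lmul_act_double_coset (gT : finGroupType) (C : {group gT})
    (B : {set gT}) (t g a : gT) :
    t \in 'N(C)%g -> a \in <[t]>%g ->
  lmul_act t (double_coset C g B) a = double_coset C (a * g)%g B.
Proof.
move=> tN at_.
have aN : a \in 'N(C)%g by move: a at_; apply/subsetP; rewrite cycle_subG.
by rewrite /= /lmul /double_coset -mulg_set1 !mulgA (norm_rlcoset aN).
Qed.

Lemma lmul_acts_double_cosets (gT : finGroupType) (C : {group gT})
    (B : {set gT}) (t : gT) :
  t \in 'N(C)%g -> [acts <[t]>, on double_cosets C B | lmul_act t]%g.
Proof.
move=> tN; apply/subsetP=> a at_; rewrite !inE at_ /=.
apply/subsetP=> _ /imsetP[g _ ->]; rewrite inE.
rewrite -[lmul _ _]/(lmul_act t _ a) lmul_act_double_coset //.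
by apply/imsetP; exists (a * g)%g.
Qed.

Definition expgz (gT : finGroupType) (x : gT) (b : int) : gT :=
  match b with Posz k => (x ^+ k)%g | Negz k => (x ^- k.+1)%g end.

(* exp(2 pi i / m) *)
Definition zeta (R : realType) (m : nat) : R[i] :=
  let theta : R := 2 * pi / m%:R in (cos theta +i* sin theta)%C.

Definition cyclic_sieving (R : realType) (gT : finGroupType) (T : finType)
    (t : gT) (to : action <[t]>%g T) (Y : {set T}) (P : {poly int}) : Prop :=
  [acts <[t]>, on Y | to]%g /\
  forall b : int,
    #|'Fix_(Y | to)[expgz t b]%g|%:R =
      (map_poly intr P).[zeta R #[t]%g ^ b] :> R[i].

(* Homogeneous polynomials of degree d in n variables.  The library makes
   dhomog n F d a vectType only when n is a successor; form removes this
   restriction. *)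
Definition form (n : nat) (F : fieldType) (d : nat) : Type := dhomog n F d.

HB.instance Definition _ (n : nat) (F : fieldType) (d : nat) :=
  GRing.Lmodule.copy (@form n F d) (dhomog n F d).
HB.instance Definition _ (n : nat) (F : fieldType) (d : nat) :=
  SubType.copy (@form n F d) (dhomog n F d).

Definition form_dim (n d : nat) : nat :=
  if n is k.+1 then 'C(d + k, d) else (d == 0)%N.

Lemma form_vecaxiom (n : nat) (F : fieldType) (d : nat) :
  Vector.axiom (form_dim n d) (form n F d).
Proof.
case: n => [|n]; last exact: dhomog_vecaxiom.
have mnm0 (m : 'X_{1..0}) : m = 0%MM by apply/mnmP; case.
have E (p q : {mpoly F[0]}) : p@_0 = q@_0 -> p = q.
  by move=> e; apply/mpolyP=> m; rewrite (mnm0 m).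
case: d => [|d] /=.
- have h (v : 'rV[F]_1) : (v 0 0)%:MP_[0] \is 0.-homog.
    by rewrite -[_%:MP_[_]]mulr1 mul_mpolyC dhomogZ // dhomog1.
  exists (fun p : form 0 F 0 => (const_mx (mpoly_of_dhomog p)@_0) : 'rV[F]_1).
    by move=> a p q; apply/rowP=> i; rewrite !mxE /= mcoeffD mcoeffZ.
  exists (fun v => DHomog (h v) : form 0 F 0) => [p|v].
    by apply/val_inj/E; rewrite /= mcoeffC eqxx mulr1 mxE.
  by apply/rowP=> i; rewrite mxE /= mcoeffC eqxx mulr1 (ord1 i).
- exists (fun _ : form 0 F d.+1 => 0 : 'rV[F]_0).
    by move=> a p q; apply/rowP=> - [].
  exists (fun _ => 0 : form 0 F d.+1) => [p|v]; last by apply/rowP=> - [].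
  apply/val_inj/E; rewrite /= mcoeff0.
  by apply/esym/(dhomog_nemf_coeff (valP p)); rewrite /= mdeg0.
Qed.

HB.instance Definition _ (n : nat) (F : fieldType) (d : nat) :=
  Lmodule_hasFinDim.Build F (form n F d) (@form_vecaxiom n F d).

Lemma msym_homog (n : nat) (F : fieldType) (d : nat) (s : 'S_n)
    (p : form n F d) :
  msym s (val p) \is d.-homog.
Proof.
apply/dhomogP=> m; rewrite mcoeff_msupp mcoeff_sym -mcoeff_msupp => pm.
exact: etrans (esym (mdeg_mperm m s)) (dhomogP _ _ _ (valP p) _ pm).
Qed.

Definition form_perm (n : nat) (F : fieldType) (d : nat) (s : 'S_n)
    (p : form n F d) : form n F d :=
  DHomog (msym_homog s p).

Lemma form_perm_is_linear (n : nat) (F : fieldType) (d : nat) (s : 'S_n) :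
  linear (@form_perm n F d s).
Proof. by move=> a p q; apply/val_inj; rewrite /= linearP. Qed.

HB.instance Definition _ (n : nat) (F : fieldType) (d : nat) (s : 'S_n) :=
  GRing.isLinear.Build F (form n F d) (form n F d) *:%R (@form_perm n F d s)
    (@form_perm_is_linear n F d s).

(* The degree d component of F[x_1, ..., x_n]^H. *)
Definition inv_form (n : nat) (F : fieldType) (H : {set 'S_n}) (d : nat) :
    {vspace form n F d} :=
  (\bigcap_(s in H) fixedSpace (linfun (@form_perm n F d s)))%VS.

Lemma inv_formP (n : nat) (F : fieldType) (H : {set 'S_n}) (d : nat)
    (p : form n F d) :
  reflect {in H, forall s, msym s (val p) = val p} (p \in inv_form F H d).
Proof.
rewrite memvE; apply: (iffP subv_bigcapP) => h s sH; have := h s sH.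
  by rewrite -memvE => /fixedSpaceP; rewrite lfunE => /(congr1 val).
by move=> e; rewrite -memvE; apply/fixedSpaceP; rewrite lfunE; apply: val_inj.
Qed.

(* Formal power series over the integers are represented by their sequences
   of coefficients. *)
Definition fps : Type := nat -> int.

Definition fps_mul (f g : fps) : fps :=
  fun k => \sum_(i < k.+1) f i * g (k - i)%N.

Definition fps_poly (p : {poly int}) : fps := fun k => p`_k.

(* The Hilbert series of F[x_1, ..., x_n]^H. *)
Definition hilbert_series (n : nat) (F : fieldType) (H : {set 'S_n}) : fps :=
  fun d => (\dim (inv_form F H d))%:Z.

(* [n]_q = 1 + q + ... + q^(n-1) *)
Definition qnum (n : nat) : {poly int} := \sum_(i < n) 'X^i.

(* Main.v *)
(* Write [K_h(q) = (1 - q) prod_(1 <= i < n) (1 - q^i) / prod_j (1 - q^(l_j))]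
   where the l_j are the cycle lengths of h.  Counting orbits of H on monomials
   (Molien's formula) and [Hilb(C[x]^(S_n)) = 1 / prod_(i <= n) (1 - q^i)] give
   [|H| Y(q) = sum_(h in H) K_h(q)].  Every K_h is a polynomial since h is not of
   type (l^(n/l)).  At a primitive d-th root of unity, d > 1, it vanishes unless
   exactly floor((n-1)/d) cycle lengths are divisible by d; if t, a power of tau
   of order d, has type (d^k, 1^r), the hypotheses on H leave only the elements
   of that type, and each of them contributes k! d^k.

   On the other side C acts freely on S_n/H, so n |H| times the number of double
   cosets fixed by t is the number of pairs (u, g) with u in Ct and u^g in H.
   As C is regular, the C-conjugates of t make up 1/r of Ct.  For r = 2 the other
   elements of Ct have only even cycles, and their squares lie in the C-class of
   t^2 (in C if t^2 = 1).  This determines their cycle types, which are among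
   those that H avoids.  Finally t has centralizer of order r k! d^k. *)
Require Import Defs.
From HB Require Import structures.
From mathcomp Require Import all_boot all_order all_fingroup all_algebra.
From mathcomp Require Import reals trigo.
From mathcomp Require Import complex mpoly.
From mathcomp Require Import cyclic zify ring.

Set Implicit Arguments.
Unset Strict Implicit.
Unset Printing Implicit Defensive.

Import Order.TTheory GRing.Theory Num.Theory.

(** * Cycle lengths and centralizers *)

Section CycleLengths.
Local Open Scope group_scope.
Variable T : finType.
Implicit Types (s t u h g : {perm T}) (x y z : T).

Definition cycle_lens s : seq nat :=
  [seq #|pred_of_set A| | A <- enum (porbits s)].

Lemma permX_eq s x i j :
  ((s ^+ i) x == (s ^+ j) x) = (i == j %[mod #|porbit s x|]).
Proof.
set k := #|porbit s x|; have k0 : 0 < k by rewrite lt0n card_porbit_neq0.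
have sk l : (s ^+ l) x = (s ^+ (l %% k)) x.
  rewrite {1}(divn_eq l k) expgD permM mulnC expgM; congr ((s ^+ _) _).
  elim: (_ %/ _) => [|q IH]; first by rewrite perm1.
  by rewrite expgS permM [(s ^+ k) x]permX iter_porbit.
rewrite (sk i) (sk j) !permX.
have nthE l : l < k -> iter l s x = nth x (traject s x k) l.
  by move=> lk; rewrite nth_traject.
rewrite !nthE ?ltn_mod // nth_uniq ?size_traject ?ltn_mod //.
exact: uniq_traject_porbit.
Qed.

Lemma permX_fixE s x i : ((s ^+ i) x == x) = (#|porbit s x| %| i).
Proof. by rewrite -{2}[x]perm1 -(expg0 s) permX_eq mod0n. Qed.

Lemma card_porbit_eq s x d : (forall i, ((s ^+ i) x == x) = (d %| i)) ->
  #|porbit s x| = d.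
Proof.
move=> e; apply/eqP; rewrite eqn_dvd -permX_fixE e dvdnn -e permX_fixE.
exact: dvdnn.
Qed.

Lemma porbit_mem_porbits s x : porbit s x \in porbits s.
Proof. exact: imset_f. Qed.

Lemma mem_porbits s (A : {set T}) x : A \in porbits s ->
  (x \in A) = (porbit s x == A).
Proof. by case/imsetP => y _ ->; rewrite eq_porbit_mem. Qed.

Lemma cycle_lens_gt0 s : all (leq 1) (cycle_lens s).
Proof.
apply/allP => _ /mapP[A + ->]; rewrite mem_enum => /imsetP[x _ ->].
by rewrite lt0n card_porbit_neq0.
Qed.

Lemma sumn_cycle_lens s : sumn (cycle_lens s) = #|T|.
Proof.
rewrite sumnE big_map big_enum -sum1_card /=.
rewrite [RHS](partition_big (porbit s) (mem (porbits s))) => [|x _]; last first.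
  exact: porbit_mem_porbits.
apply: eq_bigr => A PA; rewrite sum1dep_card; apply: eq_card => x.
by rewrite inE (mem_porbits x PA).
Qed.

Lemma count_cycle_lens s d :
  #|[set x | #|porbit s x| == d]| = (d * count_mem d (cycle_lens s))%N.
Proof.
rewrite -sum1dep_card (partition_big (porbit s) (mem (porbits s))) => [|x _]; last first.
  exact: porbit_mem_porbits.
rewrite count_map mulnC -[in RHS]sum1_count big_distrl big_enum_cond /=.
rewrite [RHS]big_mkcondr; apply: eq_bigr => A PA; rewrite mul1n.
rewrite sum1dep_card; case: eqP => [<-|ne].
  apply: eq_card => x; rewrite inE (mem_porbits x PA).
  by case: (porbit s x =P A) => [->|]; rewrite ?eqxx ?andbF.
apply/eqP; rewrite cards_eq0; apply/eqP/setP => x; rewrite !inE.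
by apply/negP => /andP[/eqP e /eqP eA]; apply: ne; rewrite -eA.
Qed.

Lemma mem_cycle_lens s d : d \in cycle_lens s -> exists x, #|porbit s x| = d.
Proof.
by case/mapP => A + ->; rewrite mem_enum => /imsetP[x _ ->]; exists x.
Qed.

Lemma cycle_lens_const s d : 0 < d -> (forall x, #|porbit s x| = d) ->
  perm_eq (cycle_lens s) (nseq (#|T| %/ d) d) /\ d %| #|T|.
Proof.
move=> d0 e.
have : all (pred1 d) (cycle_lens s).
  by apply/allP => l /mem_cycle_lens[x <-] /=; rewrite e.
move/all_pred1P => es; have := sumn_cycle_lens s.
by rewrite es sumn_nseq => <-; rewrite mulKn // dvdn_mulr.
Qed.

Lemma cycle_lens_two s d e r : d != e ->
    (forall x, #|porbit s x| = d \/ #|porbit s x| = e) ->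
    #|[set x | #|porbit s x| == e]| = (e * r)%N -> 0 < e ->
  exists k, perm_eq (cycle_lens s) (nseq k d ++ nseq r e) /\
    #|T| = (k * d + e * r)%N.
Proof.
move=> de dich ce e0; exists (count_mem d (cycle_lens s)).
have ps : perm_eq (cycle_lens s)
    (nseq (count_mem d (cycle_lens s)) d ++ nseq r e).
  rewrite perm_sym -(permPr (permEl (perm_filterC (pred1 d) (cycle_lens s)))).
  have /all_pred1P -> := filter_all (pred1 d) (cycle_lens s).
  have /all_pred1P -> : all (pred1 e) (filter (predC (pred1 d)) (cycle_lens s)).
    apply/allP => l; rewrite mem_filter => /andP[/= ld /mem_cycle_lens[x xl]].
    by case: (dich x) => ex; move: ld; rewrite -xl ex eqxx.
  rewrite !size_filter.
  suff -> : count (predC (pred1 d)) (cycle_lens s) = r by [].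
  rewrite -[RHS](mulKn _ e0) -ce count_cycle_lens mulKn //.
  apply: eq_in_count => l /mem_cycle_lens[x xl] /=.
  case: (dich x) => ex; move: ex; rewrite xl => ->; rewrite ?eqxx //.
    by rewrite (negPf de).
  by rewrite eq_sym (negPf de).
split=> //; have /perm_sumn := ps.
by rewrite sumn_cycle_lens sumn_cat !sumn_nseq mulnC.
Qed.

Lemma porbit_conj s g x : porbit (s ^ g) (g x) = g @: porbit s x.
Proof.
apply/setP => y; apply/porbitP/imsetP => [[i ->]|[z /porbitP[i ->] ->]].
  by exists ((s ^+ i) x); rewrite ?mem_porbit // -conjXg permJ.
by exists i; rewrite -conjXg permJ.
Qed.

Lemma cycle_lens_conj s g : perm_eq (cycle_lens (s ^ g)) (cycle_lens s).
Proof.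
have inj_g : injective (fun A : {set T} => g @: A) by apply/imset_inj/perm_inj.
have eP : porbits (s ^ g) = [set g @: (A : {set T}) | A in porbits s].
  apply/setP => A; apply/imsetP/imsetP => [[x _ ->]|[B /imsetP[x _ ->] ->]].
    by exists (porbit s (g^-1 x)); rewrite ?porbit_mem_porbits // -porbit_conj permKV.
  by exists (g x); rewrite // porbit_conj.
apply: (perm_trans (y := [seq #|pred_of_set A| |
    A <- [seq g @: (A : {set T}) | A <- enum (porbits s)]])).
  apply: perm_map; apply: uniq_perm; rewrite ?enum_uniq ?map_inj_uniq ?enum_uniq //.
  move=> A; rewrite mem_enum eP; apply/imsetP/mapP => [[B PB ->]|[B PB ->]].
    by exists B; rewrite ?mem_enum.
  by exists B; rewrite // -mem_enum.
rewrite -map_comp /cycle_lens (eq_map (g := fun A : {set T} => #|pred_of_set A|)) // => A /=.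
by rewrite card_imset //; apply: perm_inj.
Qed.

(** Matched cycles have equal length, so sending [(u ^+ i) (ru A)] to [(h ^+ i) (rh (phi A))] is
    well defined. The base points are parameters in order that a caller can prescribe the image of a
    chosen point. *)
Lemma orbit_matching u h (phi : {set T} -> {set T}) (ru rh : {set T} -> T) :
    {in porbits u &, injective phi} ->
    {in porbits u, forall A, phi A \in porbits h} ->
    {in porbits u, forall A, #|phi A| = #|A|} ->
    {in porbits u, forall A, ru A \in A} ->
    {in porbits h, forall A, rh A \in A} ->
  exists g, u ^ g = h /\
    forall A i, A \in porbits u -> g ((u ^+ i) (ru A)) = (h ^+ i) (rh (phi A)).
Proof.
move=> phi_inj phi_h phi_card ruA rhA.
have [idx idxP] : exists idx : T -> nat,
    forall x, x = (u ^+ idx x) (ru (porbit u x)).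
  apply: (fin_all_exists (P := fun x i => x = (u ^+ i) (ru (porbit u x)))) => x.
  apply/porbitP; have := ruA _ (porbit_mem_porbits u x).
  by rewrite porbit_sym.
pose f x := (h ^+ idx x) (rh (phi (porbit u x))).
have pr A : A \in porbits u -> porbit u (ru A) = A.
  by move=> PA; apply/eqP; rewrite -mem_porbits ?ruA.
have prh A : A \in porbits u -> porbit h (rh (phi A)) = phi A.
  by move=> PA; apply/eqP; rewrite -mem_porbits ?rhA ?phi_h.
(* Agreement of two powers at a point depends only on the cycle length. In one direction this makes
   [f] independent of the exponent, in the other injective. *)
have key A i j : A \in porbits u ->
    ((u ^+ i) (ru A) == (u ^+ j) (ru A)) =
    ((h ^+ i) (rh (phi A)) == (h ^+ j) (rh (phi A))).
  by move=> PA; rewrite !permX_eq prh ?pr ?phi_card.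
have fE A i : A \in porbits u -> f ((u ^+ i) (ru A)) = (h ^+ i) (rh (phi A)).
  move=> PA; rewrite /f porbit_perm pr //; apply/eqP; rewrite -key //.
  by have := idxP ((u ^+ i) (ru A)); rewrite porbit_perm pr // => <-.
have f_inj : injective f.
  move=> x y; rewrite /f => e.
  have PP z := porbit_mem_porbits u z.
  have eA : porbit u x = porbit u y.
    apply: phi_inj => //; rewrite -prh // -[RHS]prh //.
    by rewrite -(porbit_perm h (idx x)) e porbit_perm.
  by apply/eqP; rewrite (idxP x) (idxP y) eA key // -{1}eA e.
exists (perm f_inj); split=> [|A i PA]; last by rewrite permE fE.
apply/permP => y; rewrite -[y](permKV (perm f_inj)); set x := _ y.
rewrite permJ !permE [x]idxP -permM -expgSr !fE ?porbit_mem_porbits //.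
by rewrite expgSr permM.
Qed.

End CycleLengths.

(** The head of [s1] is paired with any element of [s2] of the same value, which is then removed
    from [s2]. The point [y0] is the value outside [s1]. *)
Lemma perm_map_matching (T1 T2 : eqType) (f : T1 -> nat) (g : T2 -> nat)
    (s1 : seq T1) (s2 : seq T2) (y0 : T2) :
    uniq s1 -> uniq s2 -> perm_eq (map f s1) (map g s2) ->
  exists phi : T1 -> T2, {in s1 &, injective phi} /\
    {in s1, forall x, phi x \in s2 /\ g (phi x) = f x}.
Proof.
elim: s1 s2 => [|x s1 IH] s2 /=; first by exists (fun=> y0).
case/andP=> xs1 us1 us2 ps.
have /mapP[y ys2 fy] : f x \in map g s2 by rewrite -(perm_mem ps) mem_head.
have p2 := perm_to_rem ys2.
have [||phi [phi_inj phiP]] := IH (rem y s2) us1.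
- exact: rem_uniq.
- by rewrite -(perm_cons (f x)) (perm_trans ps) // fy (perm_map g p2).
have ny z : z \in s1 -> phi z != y.
  by move=> /phiP[+ _]; rewrite mem_rem_uniq // inE => /andP[].
exists (fun z => if z == x then y else phi z); split=> [z w|z].
  rewrite !inE; case: eqVneq => [->|zx] /=; case: eqVneq => [->|wx] //=.
  - by move=> _ /ny + e; rewrite -e eqxx.
  - by move=> /ny + _ e; rewrite e eqxx.
  - exact: phi_inj.
rewrite inE; case: eqVneq => [->|_] //= /phiP[+ ->].
by move/mem_rem.
Qed.

(** * Conjugacy and centralizers in symmetric groups *)

Section Centralizer.
Local Open Scope group_scope.
Variable T : finType.
Implicit Types (s t u h g : {perm T}) (x y z : T).

Lemma cycle_lens_conjugate u h : perm_eq (cycle_lens u) (cycle_lens h) ->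
  exists g, u ^ g = h.
Proof.
move=> /(perm_map_matching set0 (enum_uniq _) (enum_uniq _))[phi [phi_inj phiP]].
case: (pickP (mem [set: T])) => [x0 _|noT]; last first.
  by exists 1; apply/permP => x; have := noT x; rewrite /= inE.
pose r (A : {set T}) := odflt x0 [pick x in A].
have rA s : {in porbits s, forall A, r A \in A}.
  move=> _ /imsetP[x _ ->]; rewrite /r; case: pickP => [y //|/(_ x)].
  by rewrite /= porbit_id.
case: (orbit_matching (u := u) (h := h) (phi := phi) (ru := r) (rh := r)) => //.
- by move=> A B PA PB; apply: phi_inj; rewrite mem_enum.
- by move=> A PA; have := phiP A; rewrite mem_enum => /(_ PA)[]; rewrite mem_enum.
- by move=> A PA; have := phiP A; rewrite mem_enum => /(_ PA)[].
- by move=> g [<- _]; exists g.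
Qed.

(** [orbit_matching] with [u = h = t] and the transposition of the two cycles. The base points
    differ only there, so all other cycles are fixed pointwise; if the two cycles coincide, [g]
    rotates that cycle. *)
Lemma cent1_swap t x y : #|porbit t x| = #|porbit t y| ->
  exists2 g, g \in 'C[t] & g x = y /\
    forall z, z \notin porbit t x -> z \notin porbit t y -> g z = z.
Proof.
move=> cxy; pose A := porbit t x; pose B := porbit t y.
pose phi : {set T} -> {set T} := tperm A B.
pose r (C : {set T}) := odflt x [pick z in C].
pose ru C := if C == A then x else r C.
pose rh C := if C == B then y else r C.
have rC : {in porbits t, forall C, r C \in C}.
  move=> _ /imsetP[z _ ->]; rewrite /r; case: pickP => [w //|/(_ z)].
  by rewrite /= porbit_id.
case: (orbit_matching (u := t) (h := t) (phi := phi) (ru := ru) (rh := rh)).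
- by move=> C D _ _; apply: perm_inj.
- by move=> C PC; rewrite /phi; case: tpermP => // _; apply: porbit_mem_porbits.
- by move=> C PC; rewrite /phi; case: tpermP => // ->; rewrite /A /B cxy.
- by move=> C /rC; rewrite /ru; case: eqP => [-> _|//]; apply: porbit_id.
- by move=> C /rC; rewrite /rh; case: eqP => [-> _|//]; apply: porbit_id.
move=> g [tg gP]; exists g; first by apply/cent1P; rewrite /commute [RHS]conjgC tg.
split=> [|z zA zB].
  have := gP A 0 (porbit_mem_porbits _ _).
  by rewrite !expg0 !perm1 /ru /rh /phi tpermL !eqxx.
have PC := porbit_mem_porbits t z.
have [CA CB] : porbit t z != A /\ porbit t z != B.
  by rewrite !eq_porbit_mem.
have := rC _ PC; rewrite porbit_sym => /porbitP[i ez].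
have := gP _ i PC; rewrite /ru /rh /phi (tpermD (z := porbit t z)) 1?[_ == porbit t z]eq_sym //.
by rewrite (negPf CA) (negPf CB) -ez.
Qed.

(** Orbit-stabilizer for a point [x] outside [B], by induction on [j]. The orbit is all of [~: B].
    An element that commutes with [t] and fixes [x] fixes its whole cycle, so the stabilizer is the
    same kind of group for [B] enlarged by that cycle. *)
Lemma card_cent1_fixing t (B : {set T}) d j : 0 < d ->
    {in B, forall x, t x \in B} ->
    {in ~: B, forall x, #|porbit t x| = d} ->
    #|~: B| = (j * d)%N ->
  #|'C_('C[t])(B | 'P)| = (j`! * d ^ j)%N.
Proof.
move=> d0; elim: j B => [|j IH] B tB dB cB.
  have -> : B = setT.
    by apply/eqP; rewrite -subTset -setCS setCT subset0 -cards_eq0 cB.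
  rewrite (_ : 'C_('C[t])(_ | 'P) = 1); first by rewrite cards1.
  apply/trivgP/subsetP => g /setIP[_ /astabP gP]; rewrite inE.
  by apply/eqP/permP => x; rewrite perm1; apply: gP.
have /card_gt0P[x xB] : 0 < #|~: B| by rewrite cB muln_gt0.
have orbB y z : y \in B -> z \in porbit t y -> z \in B.
  move=> yB /porbitP[i ->]; elim: i => [|i IHi]; first by rewrite perm1.
  by rewrite expgSr permM tB.
have orbC y z : y \notin B -> z \in porbit t y -> z \notin B.
  by move=> yB; rewrite porbit_sym => zy; apply: contra yB => /orbB; apply.
have xnB : x \notin B by move: xB; rewrite inE.
set Z := 'C_('C[t])(B | 'P).
have ZB g y : g \in Z -> y \in B -> g y = y.
  by case/setIP => _ /astabP gP /gP.
have ZC g y : g \in Z -> y \notin B -> g y \notin B.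
  by move=> gZ; apply: contra => gyB; rewrite -(perm_inj (ZB _ _ gZ gyB)).
have eO : orbit 'P Z x = ~: B.
  apply/setP => y; rewrite inE; apply/orbitP/idP => [[g gZ <-]|yB].
    exact: ZC.
  have [|g gC [gx gP]] := @cent1_swap t x y; first by rewrite !dB ?inE.
  exists g; last exact: gx.
  apply/setIP; split=> //; apply/astabP => z zB.
  by apply: gP; apply: contraL zB; apply: orbC.
have := card_orbit_stab 'P Z x; rewrite eO cB.
have -> : 'C_Z[x | 'P] = 'C_('C[t])(B :|: porbit t x | 'P).
  apply/setP => g; apply/setIP/setIP => [[gZ /astab1P gx]|[gC /astabP gP]].
    have /setIP[gC _] := gZ; split=> //; apply/astabP => z /setUP[|/porbitP[i ->]].
      exact: ZB.
    have /cent1P/commuteX := gC; move/(_ i) => gi.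
    by rewrite /= apermE -permM -gi permM -[g x]/('P%act x g) gx.
  split; last by apply/astab1P/gP; rewrite inE porbit_id orbT.
  by apply/setIP; split=> //; apply/astabP => z zB; apply: gP; rewrite inE zB.
have cx : #|porbit t x| = d by apply: dB.
rewrite IH.
- by move=> <-; rewrite factS expnS; lia.
- move=> z; rewrite !inE => /orP[/tB ->//|zx]; rewrite -!eq_porbit_mem.
  by rewrite -[t z]/((t ^+ 1) z) porbit_perm eq_porbit_mem zx orbT.
- by move=> z; rewrite !inE negb_or => /andP[zB _]; apply: dB; rewrite inE.
- rewrite setCU -setDE cardsD cB (setIidPr _) ?cx ?mulSn ?addKn //.
  by apply/subsetP => z; rewrite inE; apply: orbC.
Qed.

End Centralizer.

(** * Double cosets and permutations with few fixed points *)

Section Semiregular.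
Local Open Scope group_scope.
Variable T : finType.
Implicit Types (s t u h g : {perm T}) (x y z : T).

Definition fixpts t : {set T} := [set x | t x == x].

(** Equivalent to all nontrivial cycles having one length. In this form the property passes to
    powers, where the length and the number of cycles change. *)
Definition semireg t := forall x i, t x != x -> (t ^+ i) x = x -> t ^+ i = 1.

Lemma card_porbit_eq1 t x : (#|porbit t x| == 1%N) = (t x == x).
Proof. by have := permX_fixE t x 1; rewrite expg1 dvdn1 => ->. Qed.

Lemma semireg_card_porbit t m :
  (forall x, #|porbit t x| = m \/ #|porbit t x| = 1%N) -> semireg t.
Proof.
move=> dich x i tx tix; apply/permP => y; rewrite perm1; apply/eqP.
rewrite permX_fixE; move/eqP: tix; rewrite permX_fixE.
case: (dich x) => [->|/eqP]; last by rewrite card_porbit_eq1 (negPf tx).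
by case: (dich y) => ->.
Qed.


Lemma semiregX t b : semireg t -> semireg (t ^+ b).
Proof.
move=> st x i tx; rewrite -expgM; apply: st.
by apply: contra tx => /eqP tx; rewrite permX_fix.
Qed.

Lemma fixptsX t b : semireg t -> t ^+ b != 1 -> fixpts (t ^+ b) = fixpts t.
Proof.
move=> st tb; apply/setP => x; rewrite !inE; apply/eqP/eqP => [tx|]; last first.
  exact: permX_fix.
by apply/eqP; apply: contraNT tb => /st/(_ tx) ->.
Qed.

Lemma card_porbit_semireg t x : semireg t -> t x != x -> #|porbit t x| = #[t].
Proof.
move=> st tx; apply: card_porbit_eq => i; rewrite order_dvdn.
by apply/eqP/eqP => [/st -> //|->]; rewrite perm1.
Qed.

Lemma cycle_lens_semireg t r : semireg t -> t != 1 -> #|fixpts t| = r ->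
  exists k, perm_eq (cycle_lens t) (nseq k #[t] ++ nseq r 1%N) /\
    #|T| = (k * #[t] + r)%N.
Proof.
move=> st t1 cr; have [||||k] := @cycle_lens_two T t #[t] 1%N r.
- by rewrite order_eq1.
- move=> x; case: (eqVneq (t x) x) => [tx|tx]; [right|left].
    by apply/eqP; rewrite card_porbit_eq1 tx.
  exact: card_porbit_semireg.
- by rewrite mul1n -cr; apply: eq_card => x; rewrite !inE card_porbit_eq1.
- by [].
by rewrite mul1n => h; exists k.
Qed.

(** Orbit-stabilizer at a fixed point [p]: the centralizer is transitive on the [r] fixed points,
    and as [r] is at most 2, fixing [p] means fixing all of them. *)
Lemma card_cent1_semireg t k r : semireg t -> t != 1 -> #|fixpts t| = r ->
    0 < r <= 2 -> #|T| = (k * #[t] + r)%N ->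
  #|'C[t]| = (r * (k`! * #[t] ^ k))%N.
Proof.
move=> st t1 cr r2 cT.
have /card_gt0P[p pF] : 0 < #|fixpts t| by rewrite cr; case/andP: r2.
have tp : t p = p by move: pF; rewrite inE => /eqP.
have fix_cent g x : g \in 'C[t] -> x \in fixpts t -> g x \in fixpts t.
  move=> /cent1P gt; rewrite !inE -permM gt permM.
  by move=> /eqP ->.
have tF x : x \in fixpts t -> porbit t x = [set x].
  rewrite inE -card_porbit_eq1 => /cards1P[y e].
  by have := porbit_id t x; rewrite e inE => /eqP ->.
have <- := card_orbit_stab 'P 'C[t] p; congr (_ * _)%N.
  rewrite -cr; apply: eq_card => y; apply/orbitP/idP => [[g gC <-]|yF].
    exact: fix_cent.
  have [|g gC [gx _]] := @cent1_swap T t p y; first by rewrite !tF ?cards1.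
  by exists g.
rewrite -(card_cent1_fixing (t := t) (B := fixpts t)) ?order_gt0 //.
- apply: eq_card => g; apply/setIP/setIP => [[gC /astab1P gp]|[gC /astabP gp]].
    split=> //; apply/astabP => y yF; rewrite /= apermE.
    have {}gp : g p = p := gp.
    have [->//|yp] := eqVneq y p.
    have /subset_leq_card : [set p; y; g y] \subset fixpts t.
      by apply/subsetP => z /setUP[/set2P[]->|/set1P ->] //; apply: fix_cent.
    apply: contraTeq => gy; rewrite cr -ltnNge.
    have gyp : g y != p by rewrite -[X in _ != X]gp (inj_eq perm_inj).
    rewrite setUC cardsU1 cards2 !inE negb_or gyp gy [p == y]eq_sym yp.
    by case/andP: r2.
  by split=> //; apply/astab1P/gp.
- by move=> x xF; move: (xF); rewrite {1}inE => /eqP ->.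
- by move=> x; rewrite !inE => tx; apply: card_porbit_semireg.
- have := cardsC (fixpts t); rewrite cr cT addnC => /eqP.
  by rewrite eqn_add2r => /eqP.
Qed.

End Semiregular.

(** * Counting fixed double cosets when C acts freely on the cosets of H *)

Section DoubleCosets.
Local Open Scope group_scope.
Variables (gT : finGroupType) (C H : {group gT}).
Hypothesis free : forall c g, c \in C -> c ^ g \in H -> c = 1.

Lemma mem_double_coset g x :
  reflect (exists c h, [/\ c \in C, h \in H & x = c * g * h])
          (x \in double_coset C g H).
Proof.
apply: (iffP mulsgP) => [[y h /mulsgP[c g' Cc /set1P -> ->] Hh ->]|].
  by exists c, h.
move=> [c [h [Cc Hh ->]]]; exists (c * g) h => //.
by apply/mulsgP; exists c g; rewrite ?set11.
Qed.

Lemma double_coset_id g : g \in double_coset C g H.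
Proof. by apply/mem_double_coset; exists 1, 1; rewrite mul1g mulg1. Qed.

Lemma double_coset_eq g x :
  (double_coset C x H == double_coset C g H) = (x \in double_coset C g H).
Proof.
apply/eqP/idP => [<-|]; first exact: double_coset_id.
case/mem_double_coset => c [h [Cc Hh ->]]; apply/setP => y.
apply/mem_double_coset/mem_double_coset => [[c' [h' [Cc' Hh' ->]]]|[c' [h' [Cc' Hh' ->]]]].
  by exists (c' * c), (h * h'); rewrite !groupM // !mulgA.
exists (c' * c^-1), (h^-1 * h'); rewrite !groupM ?groupV //; split=> //.
by rewrite !mulgA mulgKV mulgK.
Qed.

Lemma card_double_coset g : #|double_coset C g H| = (#|C| * #|H|)%N.
Proof.
rewrite -cardsX; pose f (z : gT * gT) := z.1 * g * z.2.
have <- : f @: (setX C H) = double_coset C g H.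
  apply/setP => x; apply/imsetP/mem_double_coset => [[[c h]]|[c [h [Cc Hh ->]]]].
    by rewrite inE => /andP[Cc Hh] ->; exists c, h.
  by exists (c, h); rewrite ?inE ?Cc.
apply: card_in_imset => [[c h] [c' h']]; rewrite !inE /f /=.
move=> /andP[Cc Hh] /andP[Cc' Hh'] e.
have e2 : (c'^-1 * c) ^ g = h' * h^-1.
  apply: (mulIg h); rewrite mulgKV; apply: (mulgI (c' * g)).
  by rewrite -e conjgE !mulgA mulgK mulgV mul1g.
have cc : c'^-1 * c = 1.
  by apply: (free (g := g)); [rewrite groupM ?groupV | rewrite e2 groupM ?groupV].
have ec : c = c' by rewrite -[RHS]mulg1 -cc mulKVg.
by move: e; rewrite ec => /mulgI ->.
Qed.

(** Double counting of the [g] whose double coset is fixed. An equality [t * g = c * g * h] says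
    that [u = c^-1 * t] satisfies [u ^ g = h], and freeness makes such a [u] unique in its coset. *)
Lemma card_fix_double_cosets tau t :
    tau \in 'N(C) -> t \in <[tau]> ->
  (#|C| * #|H| * #|'Fix_(double_cosets C H | lmul_act tau)[t]|)%N =
    (\sum_(u in (C :* t)%g) #|[set g | (u ^ g)%g \in H]|)%N.
Proof.
move=> tauN tt; set Fx := 'Fix_(_ | _)[t].
have FxP g : (double_coset C g H \in Fx) = (t * g \in double_coset C g H).
  rewrite in_setI; have -> : double_coset C g H \in double_cosets C H.
    by apply: imset_f; rewrite in_setT.
  rewrite -double_coset_eq -(lmul_act_double_coset _ _ tauN tt).
  by apply/afix1P/eqP.
transitivity #|[set g | double_coset C g H \in Fx]|.
  rewrite -[RHS]sum1dep_card.
  rewrite (partition_big (fun g => double_coset C g H) (mem Fx)) //=.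
  rewrite mulnC -sum_nat_const; apply: eq_bigr => D DF.
  have /setIP[/imsetP[g _ eD] _] := DF.
  rewrite sum1dep_card -(card_double_coset g) -eD.
  apply: eq_card => x; rewrite inE; case: (eqVneq (double_coset C x H) D) => [e|ne].
    by rewrite e DF -e double_coset_id.
  by rewrite andbF; apply/negP => xD; move: ne; rewrite eD double_coset_eq -eD xD.
under [RHS]eq_bigr => u _ do rewrite -sum1dep_card big_mkcond.
rewrite exchange_big -sum1dep_card big_mkcond /=; apply: eq_bigr => g _.
rewrite FxP -big_mkcondr sum1dep_card.
case: (boolP (t * g \in _)) => [/mem_double_coset[c [h [Cc Hh e]]]|no].
  apply/esym/eqP/cards1P; exists (c^-1 * t); apply/setP => u.
  have eh : (c^-1 * t) ^ g = h by rewrite conjgE -!mulgA e !mulgA mulgKV mulVg mul1g.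
  rewrite !inE; apply/andP/eqP => [[uC uH]|->]; last first.
    by rewrite eh Hh mem_rcoset mulgK groupV.
  apply/eqP; rewrite eq_mulgV1; apply/eqP; apply: (free (g := g)).
    move: uC; rewrite mem_rcoset => uC.
    by rewrite invMg invgK mulgA groupM.
  by rewrite conjMg conjVg eh groupM ?groupV.
apply/esym/eqP; rewrite cards_eq0; apply/eqP/setP => u; rewrite !inE.
apply/negP => /andP[/rcosetP[c Cc ->] uH]; case/negP: no.
apply/mem_double_coset; exists c^-1, ((c * t) ^ g); rewrite groupV uH; split=> //.
by rewrite conjgE !mulgA mulgK mulVg mul1g.
Qed.

End DoubleCosets.

Section ConjugatesInSubgroup.
Local Open Scope group_scope.

(** The fibres of [g |-> t ^ g] over the class of [t] are cosets of ['C[t]]. *)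
Lemma card_conj_in (gT : finGroupType) (H : {group gT}) (t : gT) :
  #|[set g | t ^ g \in H]| = (#|'C[t]| * #|[set h in H | h \in t ^: [set: gT]]|)%N.
Proof.
set A := [set h in H | _].
rewrite -sum1dep_card.
rewrite (partition_big (conjg t) (mem A)) => [|g tg]; last first.
  by rewrite !inE tg imset_f ?inE.
rewrite mulnC -sum_nat_const; apply: eq_bigr => h.
move=> /setIdP[Hh /imsetP[g0 _ eh]].
rewrite sum1dep_card -(card_rcoset 'C[t] g0); apply: eq_card => g.
rewrite inE mem_rcoset; apply/andP/cent1P => [[_ /eqP tg]|/commute_sym/commgP/conjg_fixP tg].
  by apply/commute_sym/commgP/conjg_fixP; rewrite conjgM tg eh conjgK.
have tg2 : t ^ g = h by rewrite -[g](mulgKV g0) conjgM tg eh.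
by rewrite tg2 Hh.
Qed.

End ConjugatesInSubgroup.

(** * A regular abelian group C and the coset C t of a normalizing element *)

Section RegularSubgroup.
Local Open Scope group_scope.
Variables (T : finType) (C : {group {perm T}}).
Implicit Types (t u c : {perm T}) (x y p : T).
Hypothesis abC : abelian C.
Hypothesis regC : forall c x, c \in C -> c x = x -> c = 1.
Hypothesis transC : forall x y, exists2 c, c \in C & c x = y.

Let comC a b : a \in C -> b \in C -> a * b = b * a.
Proof. by move=> Ca Cb; apply: (centsP abC). Qed.

Lemma regular_inj a b p : a \in C -> b \in C -> a p = b p -> a = b.
Proof.
move=> Ca Cb e; have : a * b^-1 = 1.
  by apply: (@regC _ p); rewrite ?groupM ?groupV // permM e permK.
by move/eqP; rewrite -eq_mulgV1 => /eqP.
Qed.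

Lemma card_regular p : #|C| = #|T|.
Proof.
have -> : #|C| = #|[set (c : {perm T}) p | c in C]|.
  by rewrite card_in_imset // => c c' Cc Cc'; apply: regular_inj.
apply: eq_card => x; apply/imsetP; have [c Cc <-] := transC p x.
by exists c.
Qed.

Lemma class_sub_coset t : t \in 'N(C) -> t ^: C \subset C :* t.
Proof.
move=> tN; apply/subsetP => _ /imsetP[x Cx ->].
rewrite mem_rcoset conjgE -!mulgA groupM ?groupV //.
by rewrite -{1}[t]invgK -conjgE memJ_norm ?groupV.
Qed.

(** By regularity [c |-> c p] identifies the centralizer of [t] in [C] with the fixed points of [t];
    its index in [C] is the size of the class. *)
Lemma card_class_fixpts t p : t \in 'N(C) -> t p = p ->
  (#|t ^: C| * #|fixpts t|)%N = #|C|.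
Proof.
move=> tN tp; rewrite -index_cent1 mulnC -(Lagrange (subsetIl C 'C[t])).
congr (_ * _)%N; rewrite -(card_in_imset (f := fun c : {perm T} => c p)); last first.
  by move=> c c' /setIP[Cc _] /setIP[Cc' _]; apply: regular_inj.
apply: eq_card => x; rewrite inE; apply/eqP/imsetP => [tx|[c /setIP[Cc /cent1P ct] ->]].
  have [c Cc cp] := transC p x; exists c => //.
  apply/setIP; split=> //; apply/cent1P/commgP/conjg_fixP.
  apply: (@regular_inj _ _ p); rewrite ?memJ_norm //.
  by rewrite conjgE !permM -{1}tp permK cp tx.
by rewrite -permM ct permM tp.
Qed.

Lemma sum_coset_conj t (H : {group {perm T}}) : t \in 'N(C) ->
    (forall u g, u \in C :* t -> u \notin t ^: C -> u ^ g \notin H) ->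
  (\sum_(u in (C :* t)%g) #|[set g | (u ^ g)%g \in H]|)%N =
    (#|t ^: C| * #|[set g | (t ^ g)%g \in H]|)%N.
Proof.
move=> tN no; rewrite (bigID (mem (t ^: C))) /= addnC big1 => [|u /andP[uC ut]]; last first.
  by apply/eqP; rewrite cards_eq0; apply/eqP/setP => g; rewrite !inE (negPf (no u g uC ut)).
rewrite add0n -sum_nat_const; apply: eq_big => [u|u /andP[_ /imsetP[x Cx ->]]].
  by case: (boolP (u \in t ^: C)) => [/(subsetP (class_sub_coset tN)) ->|]; rewrite ?andbF.
rewrite -(card_lcoset [set g | t ^ g \in H] x^-1); apply: eq_card => g.
by rewrite mem_lcoset !inE invgK conjgM.
Qed.

(** [C, t] as a bare set of commutators. For [t] normalizing the abelian group [C], [x |-> [~ x, t]]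
    is a homomorphism on [C], so this set is already a subgroup. *)
Definition commset t := [set [~ x, t] | x in C : {set {perm T}}].

Lemma commset_sub t : t \in 'N(C) -> commset t \subset C.
Proof.
move=> tN; apply/subsetP => _ /imsetP[x Cx ->].
by rewrite commgEl groupM ?groupV ?memJ_norm.
Qed.

Lemma commset_group t : t \in 'N(C) -> group_set (commset t).
Proof.
move=> tN; apply/group_setP; split.
  by apply/imsetP; exists 1; rewrite ?comm1g.
move=> _ _ /imsetP[x Cx ->] /imsetP[y Cy ->]; apply/imsetP; exists (x * y).
  exact: groupM.
have xt : x ^ t \in C by rewrite memJ_norm.
have yt : y ^ t \in C by rewrite memJ_norm.
rewrite !commgEl conjMg invMg.
transitivity (y^-1 * (x^-1 * x ^ t) * y ^ t); last by rewrite !mulgA.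
have ac : x^-1 * x ^ t \in C by rewrite groupM ?groupV.
by rewrite [y^-1 * (x^-1 * x ^ t)]comC ?groupV // !mulgA.
Qed.

Lemma class_commset t : t \in 'N(C) -> t ^: C = t *: commset t.
Proof.
move=> tN; apply/setP => u; rewrite mem_lcoset; apply/imsetP/imsetP => [[x Cx ->]|[x Cx e]].
  exists x^-1; rewrite ?groupV // commgEl invgK.
  by rewrite [RHS]comC ?memJ_norm ?groupV // !conjgE !mulgA.
exists x^-1; rewrite ?groupV //; apply: (mulgI t^-1); rewrite e.
rewrite commgEl [LHS]comC ?groupV ?memJ_norm //.
by rewrite !conjgE invgK !mulgA.
Qed.

End RegularSubgroup.

Section IndexTwo.
Local Open Scope group_scope.

Lemma index2_mul (gT : finGroupType) (K C : {group gT}) a b :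
    K \subset C -> (#|K| * 2)%N = #|C| -> a \in C -> a \notin K -> b \in C ->
  (b * a \in K) = (b \notin K).
Proof.
move=> sKC c2 Ca aK Cb; case: (boolP (b \in K)) => [bK|bK]; first by rewrite groupMl // (negPf aK).
have e : K :* a^-1 = C :\: K.
  apply/eqP; rewrite eqEcard; apply/andP; split.
    apply/subsetP => _ /rcosetP[k Kk ->]; rewrite inE groupMl // groupV aK.
    by rewrite groupM ?groupV // (subsetP sKC).
  by rewrite card_rcoset cardsD (setIidPr sKC) -c2 muln2 -addnn addKn.
have : b \in C :\: K by rewrite inE bK.
by rewrite -e mem_rcoset invgK.
Qed.

End IndexTwo.

Section CycleLengthTransfer.
Local Open Scope group_scope.
Variable T : finType.
Implicit Types (s u g : {perm T}) (x y : T).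

Lemma card_porbit_double u y : (forall i, (u ^+ i) y = y -> ~~ odd i) ->
  #|porbit u y| = (2 * #|porbit (u ^+ 2) y|)%N.
Proof.
move=> par; apply: card_porbit_eq => i; have [oi|ei] := boolP (odd i).
  have -> : (2 * #|porbit (u ^+ 2) y| %| i) = false.
    by apply: contraTF oi => /(dvdn_trans (dvdn_mulr _ (dvdnn 2))); rewrite dvdn2.
  by apply/negP => /eqP/par; rewrite oi.
rewrite -(odd_double_half i) (negPf ei) add0n -mul2n expgM permX_fixE.
by rewrite dvdn_pmul2l.
Qed.

Lemma card_porbit_conj_pred s g d :
  #|[set y | #|porbit (s ^ g) y| == d]| = #|[set y | #|porbit s y| == d]|.
Proof. by rewrite !count_cycle_lens (seq.permP (cycle_lens_conj s g)). Qed.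

Lemma fixpts_card_porbit s : fixpts s = [set y | #|porbit s y| == 1%N].
Proof. by apply/setP => y; rewrite !inE card_porbit_eq1. Qed.

End CycleLengthTransfer.

(** * Elements of C t outside the class of t, when t fixes two points *)

Section TwoFixedPoints.
Local Open Scope group_scope.
Variables (T : finType) (C : {group {perm T}}).
Implicit Types (t u c : {perm T}) (x y p : T).
Hypothesis abC : abelian C.
Hypothesis regC : forall c x, c \in C -> c x = x -> c = 1.
Hypothesis transC : forall x y, exists2 c, c \in C & c x = y.

Lemma card_commset t p : t \in 'N(C) -> t p = p ->
  (#|commset C t| * #|fixpts t|)%N = #|C|.
Proof.
move=> tN tp; rewrite -(card_class_fixpts regC transC tN tp).
by rewrite class_commset // card_lcoset.
Qed.

Variables (t : {perm T}) (p : T).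
Hypotheses (tN : t \in 'N(C)) (tp : t p = p) (ct : #|fixpts t| = 2).

Let K : {group {perm T}} := Group (commset_group abC tN).

Let sKC : K \subset C.
Proof. exact: commset_sub. Qed.

Let cK : (#|K| * 2)%N = #|C|.
Proof. by rewrite -ct; apply: (card_commset tN tp). Qed.

Let coset_split u : u \in C :* t -> u \notin t ^: C ->
  exists2 c, c \in C & c \notin K /\ u = t * c.
Proof.
rewrite (norm_rlcoset tN) => /lcosetP[c Cc ->]; rewrite class_commset //.
by rewrite mem_lcoset mulKg => cnK; exists c.
Qed.

(** [t] preserves the set of points [x p] with [x] in [K], since [x ^ t] lies in the coset of [x]
    modulo [K], and a factor [c] outside [K] exchanges this set with its complement. So all cycles
    of [u] are even. *)
Lemma non_class_parity u : u \in C :* t -> u \notin t ^: C ->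
  exists E : pred T, forall y, E (u y) = ~~ E y.
Proof.
move=> uC /(coset_split uC)[c Cc [cnK ->]].
(* the orbit of p under the index 2 subgroup K = [C, t] *)
pose E y := y \in [set (k : {perm T}) p | k in K].
have EP a : a \in C -> E (a p) = (a \in K).
  move=> Ca; apply/imsetP/idP => [[k Kk e]|Ka]; last by exists a.
  by rewrite (regular_inj regC Ca (subsetP sKC _ Kk) e).
exists E => y; have [x Cx <-] := transC p y.
have -> : (t * c) (x p) = (x ^ t * c) p.
  by rewrite -permM mulgA [x * t]conjgC -mulgA permM tp.
have Cxt : x ^ t \in C by rewrite memJ_norm.
rewrite (EP _ (groupM Cxt Cc)) (EP _ Cx) (index2_mul sKC cK Cc cnK Cxt); congr (~~ _).
have -> : x ^ t = x * [~ x, t] by rewrite commgEl mulKVg.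
by rewrite groupMr //; apply: imset_f.
Qed.

Let odd_free u y i : u \in C :* t -> u \notin t ^: C ->
  (u ^+ i) y = y -> ~~ odd i.
Proof.
move=> uC un; have [E EP] := non_class_parity uC un.
have Ei : E ((u ^+ i) y) = odd i (+) E y.
  elim: i => [|i IH]; first by rewrite perm1.
  by rewrite expgSr permM EP IH /= addNb.
by move=> e; move: Ei; rewrite e; case: (odd i) (E y) => [] [].
Qed.

(** The square of [t * c] is [t ^+ 2 * (c ^ t * c)], and [c ^ t * c = c * c * [~ c, t]], where
    [c * c] lies in [K] because the index is 2. *)
Lemma non_class_square u : u \in C :* t -> u \notin t ^: C ->
  exists2 c, c \in K & u ^+ 2 = t ^+ 2 * c.
Proof.
move=> uC /(coset_split uC)[c Cc [cnK ->]]; exists (c ^ t * c).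
  have -> : c ^ t * c = c * c * [~ c, t].
    rewrite commgEl mulgA mulgK; apply: (centsP abC) => //.
    by rewrite memJ_norm.
  rewrite groupM //; first by rewrite (index2_mul sKC cK).
  exact: imset_f.
by rewrite !expgS !expg0 !mulg1 conjgE !mulgA mulgK.
Qed.

(** Now [u ^+ 2] lies in the regular group [C], so its cycles all have its order as length, and
    those of [u] are twice as long. *)
Lemma non_class_cycle_lens_involution u : t ^+ 2 = 1 ->
    u \in C :* t -> u \notin t ^: C ->
  exists l, [/\ 1 < l, l %| #|T| & perm_eq (cycle_lens u) (nseq (#|T| %/ l) l)].
Proof.
move=> t2 uC un; have [c Kc u2] := non_class_square uC un.
have {}u2 : u ^+ 2 \in C by rewrite u2 t2 mul1g (subsetP sKC).
exists (2 * #[u ^+ 2])%N; have o0 := order_gt0 (u ^+ 2).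
have [||ps dv] := @cycle_lens_const T u (2 * #[u ^+ 2])%N.
- by rewrite muln_gt0.
- move=> y; rewrite card_porbit_double => [|i]; last exact: odd_free.
  congr (_ * _)%N; apply: card_porbit_eq => i; rewrite order_dvdn.
  by apply/eqP/eqP => [|->]; [apply/regC/groupX | rewrite perm1].
by split=> //; lia.
Qed.

(** Here [u ^+ 2] is a [C]-conjugate of [t ^+ 2]. Cycle lengths double in passing from [u ^+ 2] to
    [u], and the single 2-cycle comes from the two fixed points. *)
Lemma non_class_cycle_lens u : semireg t -> t ^+ 2 != 1 ->
    u \in C :* t -> u \notin t ^: C ->
  exists k, perm_eq (cycle_lens u) (nseq k (2 * #[(t ^+ 2)%g])%N ++ [:: 2%N]) /\
    #|T| = (k * (2 * #[(t ^+ 2)%g]) + 2)%N.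
Proof.
move=> st t2 uC un; have [c Kc u2] := non_class_square uC un.
have t2N : t ^+ 2 \in 'N(C) by rewrite groupX.
have t2p : (t ^+ 2) p = p by rewrite permX_fix.
have ct2 : #|fixpts (t ^+ 2)| = 2 by rewrite fixptsX.
(* The commutator identity for [[~ x, t * t]] gives one inclusion; as [t ^+ 2] also has two fixed
   points, both groups have index 2. *)
have sK2 : commset C (t ^+ 2) = K.
  apply/eqP; rewrite eqEcard; apply/andP; split.
    apply/subsetP => _ /imsetP[x Cx ->]; rewrite expgS expg1.
    have -> : [~ x, t * t] = [~ x, t] * [~ x ^ t, t].
      by rewrite !commgEl conjgM -mulgA mulKVg.
    by apply: (@groupM _ K); apply: imset_f => //; rewrite memJ_norm.
  by rewrite -(leq_pmul2r (isT : 0 < 2)) cK -(card_commset t2N t2p) ct2.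
have /imsetP[x Cx ux] : u ^+ 2 \in (t ^+ 2) ^: C.
  by rewrite class_commset // sK2 u2 mem_lcoset mulKg.
have od : #[t ^+ 2] != 1%N by rewrite order_eq1.
have [|y|||k [ps eT]] := @cycle_lens_two T u (2 * #[(t ^+ 2)%g])%N 2%N 1%N.
- by have := order_gt0 (t ^+ 2); lia.
- rewrite card_porbit_double => [|i]; last exact: odd_free.
  rewrite ux -[y](permKV x) porbit_conj card_imset; last exact: perm_inj.
  case: (eqVneq ((t ^+ 2) (x^-1 y)) (x^-1 y)) => [/eqP|ty].
    by rewrite -card_porbit_eq1 => /eqP ->; right.
  by left; rewrite (card_porbit_semireg (semiregX st) ty).
- transitivity #|fixpts (t ^+ 2)|; last by rewrite ct2.
  rewrite fixpts_card_porbit -(card_porbit_conj_pred (t ^+ 2) x) -ux.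
  apply: eq_card => y; rewrite !inE card_porbit_double => [|i]; last exact: odd_free.
  by lia.
- by [].
by exists k.
Qed.

End TwoFixedPoints.

Section FixedDoubleCosets.
Local Open Scope group_scope.
Variables (T : finType) (C H : {group {perm T}}).
Implicit Types (t u c : {perm T}) (x y p : T).
Hypothesis abC : abelian C.
Hypothesis regC : forall c x, c \in C -> c x = x -> c = 1.
Hypothesis transC : forall x y, exists2 c, c \in C & c x = y.
Hypothesis free : forall c g, c \in C -> c ^ g \in H -> c = 1.
Variables (tau t : {perm T}) (k r : nat).
Hypotheses (tauN : tau \in 'N(C)) (tt : t \in <[tau]>).

Lemma card_fix_double_cosets_1 : t = 1 ->
  (#|C| * #|H| * #|'Fix_(double_cosets C H | lmul_act tau)[t]|)%N = (#|T|)`!.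
Proof.
move=> t1; rewrite (card_fix_double_cosets free tauN tt) t1 rcoset1.
rewrite (bigD1 1) //= big1 => [|u /andP[Cu u1]]; last first.
  apply/eqP; rewrite cards_eq0; apply/eqP/setP => g; rewrite !inE.
  by apply/negP => /(free Cu)/eqP; apply/negP.
rewrite addn0 -cardsT -card_perm; apply: eq_card => g; rewrite !inE conj1g group1.
by apply/esym/subsetP => x; rewrite inE.
Qed.

(** [C] has order [r] times that of the class [t ^: C], and the centralizer of [t] has order r k!
    d^k with d the order of [t]. The common factor [#|t ^: C| * r] cancels. *)
Lemma card_fix_double_cosets_semireg :
    semireg t -> t != 1 -> #|fixpts t| = r -> 0 < r <= 2 ->
    #|T| = (k * #[t] + r)%N ->
    (forall u g, u \in C :* t -> u \notin t ^: C -> u ^ g \notin H) ->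
  (#|H| * #|'Fix_(double_cosets C H | lmul_act tau)[t]|)%N =
    (k`! * #[t] ^ k * #|[set h in H | h \in t ^: [set: {perm T}]]|)%N.
Proof.
move=> st t1 cr r2 cT no.
have tN : t \in 'N(C) by move: tt; apply/subsetP; rewrite cycle_subG.
have /card_gt0P[p] : 0 < #|fixpts t| by rewrite cr; case/andP: r2.
rewrite inE => /eqP tp.
have := card_fix_double_cosets free tauN tt.
rewrite (sum_coset_conj tN no) card_conj_in.
rewrite (card_cent1_semireg st t1 cr r2 cT).
have := card_class_fixpts regC transC tN tp; rewrite cr => e.
have C0 := cardG_gt0 C; rewrite -e in C0 *.
set a := #|t ^: C| in C0 *; set h := #|H|; set f := #|'Fix_(_ | _)[_]|.
set q := #|[set _ in _ | _]|; set w := (k`! * _)%N => e2.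
by apply/eqP; rewrite -(eqn_pmul2l C0); apply/eqP; rewrite mulnA e2; lia.
Qed.

End FixedDoubleCosets.

Local Open Scope ring_scope.

(** * Products of factors 1 - q^l at roots of unity *)

Section Parts.

Lemma leq_size_sumn d s : all (dvdn d) s -> all (leq 1) s ->
  (size s * d <= sumn s)%N.
Proof.
elim: s => //= a t IH /andP[da dt] /andP[a0 t0].
by rewrite mulSn; apply: leq_add; [apply: dvdn_leq | apply: IH].
Qed.

Lemma all_dvdn_nseq d s : all (dvdn d) s -> all (leq 1) s ->
  (sumn s <= size s * d)%N -> s = nseq (size s) d.
Proof.
elim: s => //= a s IH /andP[da ds] /andP[a0 s0] le.
have := leq_size_sumn ds s0; have ha := dvdn_leq a0 da => le2.
have ea : a = d by nia.
by rewrite -IH ?ea //; nia.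
Qed.

Lemma all_leq1_nseq s : all (leq 1) s -> (sumn s <= size s)%N ->
  s = nseq (size s) 1%N.
Proof.
by move=> s0 le; apply: all_dvdn_nseq; rewrite ?muln1 //; apply/allP.
Qed.

Lemma sumn_filterC (a : pred nat) s :
  sumn s = (sumn (filter a s) + sumn (filter (predC a) s))%N.
Proof. by rewrite -sumn_cat; apply/perm_sumn; rewrite perm_sym perm_filterC. Qed.

Lemma all_filter_sub T (a p : pred T) s : all p s -> all p (filter a s).
Proof. by rewrite all_filter; apply: sub_all => x px; apply/implyP. Qed.

Lemma count_dvdn_full d s : (0 < d)%N -> all (leq 1) s -> (d %| sumn s)%N ->
  count (dvdn d) s = (sumn s %/ d)%N -> perm_eq s (nseq (sumn s %/ d) d).
Proof.
move=> d0 s0 ds cs.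
have sf : size (filter (dvdn d) s) = (sumn s %/ d)%N by rewrite size_filter.
have lb := leq_size_sumn (filter_all (dvdn d) s) (all_filter_sub _ s0).
have := sumn_filterC (dvdn d) s; rewrite sf divnK // in lb * => es.
have e1 := all_dvdn_nseq (filter_all (dvdn d) s) (all_filter_sub _ s0).
rewrite sf divnK // in e1.
have e2 := leq_size_sumn (d:=1) (s := filter (predC (dvdn d)) s).
rewrite perm_sym -(permPr (permEl (perm_filterC (dvdn d) s))) -e1 ?cats0; last by lia.
have /size0nil -> : size (filter (predC (dvdn d)) s) = 0%N; last by rewrite cats0.
have : (size (filter (predC (dvdn d)) s) * 1 <= 0)%N; last by lia.
rewrite (leq_trans (e2 _ _)) ?all_filter_sub //; last by lia.
by apply/allP.
Qed.

(** The parts divisible by [d] sum to some [j * d] with [k <= j], and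
    [j * d <= k * d + r <= k.+1 * d]. If [j = k] these parts all equal [d]; if [j = k.+1] then
    [r = d] and nothing is left for other parts. *)
Lemma count_dvdn_rem d k r s : (1 < d)%N -> (0 < r <= d)%N -> all (leq 1) s ->
    sumn s = (k * d + r)%N -> count (dvdn d) s = k ->
  sumn (filter (predC (dvdn d)) s) = r /\ filter (dvdn d) s = nseq k d
  \/ r = d /\ all (dvdn d) s.
Proof.
move=> d1 rd s0 es cs.
have sf : size (filter (dvdn d) s) = k by rewrite size_filter.
have lb := leq_size_sumn (filter_all (dvdn d) s) (all_filter_sub _ s0).
have e := sumn_filterC (dvdn d) s.
have dd : (d %| sumn (filter (dvdn d) s))%N.
  elim: (s) => //= a t IH; case: ifP => //= da; exact: dvdn_add.
case/dvdnP: dd => j ej; rewrite sf ej es in lb e.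
have [jk|jk] := eqVneq j k.
  left; split; first by lia.
  have := all_dvdn_nseq (filter_all (dvdn d) s) (all_filter_sub _ s0).
  by rewrite sf ej jk; apply.
right.
have ejk : j = k.+1.
  have d0 := ltnW d1.
  have kj : (k <= j)%N by rewrite -(leq_pmul2r d0).
  have : (j <= k.+1)%N by rewrite -(leq_pmul2r d0); lia.
  by move: jk; lia.
have rd' : r = d by nia.
split=> //; apply/allP => x xs; apply/negPn/negP => dx.
have xf : x \in filter (predC (dvdn d)) s by rewrite mem_filter /= dx.
have /perm_sumn := perm_to_rem xf; rewrite /=.
by have := allP s0 x xs; nia.
Qed.

Lemma parts_of_two s : all (leq 1) s -> sumn s = 2%N ->
  s = [:: 2%N] \/ s = [:: 1%N; 1%N].
Proof.
case: s => [|a [|b [|c s]]] //=; rewrite ?addn0 ?andbT.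
- by move=> _ ->; left.
- by move=> /andP[a0 b0] ab; right; congr [:: _; _]; lia.
- by move=> /and4P[a0 b0 c0 _]; lia.
Qed.

(** Even parts are at least 2, and the total exceeds this minimum by 2 only. *)
Lemma all_even_excess s k : all (leq 1) s -> all (dvdn 2) s -> size s = k.+1 ->
  sumn s = (k.+1 * 2 + 2)%N -> perm_eq s (4%N :: nseq k 2%N).
Proof.
elim: k s => [|k IH] s s0 s2 ss es.
  case: s ss es {s2 s0} => [|a [|b s]] //= _; rewrite addn0 => ->.
  exact: perm_refl.
case: s s0 s2 ss es => [|a s] //= /andP[a0 s0] /andP[a2 s2] [ss] es.
have lb := leq_size_sumn s2 s0.
have [a2'|na2] := eqVneq a 2%N.
  rewrite a2' (perm_trans (y := 2%N :: 4%N :: nseq k 2%N)) //.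
    by rewrite perm_cons IH //; lia.
  by rewrite (perm_catCA [:: 2%N] [:: 4%N]).
have a4 : (4 <= a)%N by case/dvdnP: a2 => j ej; lia.
have -> : a = 4%N by lia.
rewrite perm_cons {1}(all_dvdn_nseq s2 s0); first by rewrite ss.
by lia.
Qed.

End Parts.

(** * Divisibility of (q; q)_n by products of 1 - q^l, and values of the quotients *)

Section Cyclotomic.

Definition cyc_prod (A : comNzRingType) (s : seq nat) : {poly A} :=
  \prod_(l <- s) (1 - 'X^l).

(** The q-Pochhammer symbol (q; q)_n, written as a [cyc_prod] so that [cyc_prod_reducedE] applies to
    it. *)
Definition qpoch (A : comNzRingType) (n : nat) : {poly A} :=
  cyc_prod A (iota 1 n).

Lemma qpochS (A : comNzRingType) n : qpoch A n.+1 = (1 - 'X^(n.+1)) * qpoch A n.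
Proof.
by rewrite /qpoch -[n.+1]addn1 iotaD /cyc_prod big_cat big_seq1 addn1 add1n mulrC.
Qed.

Lemma qpoch0 (A : comNzRingType) : qpoch A 0 = 1.
Proof. exact: big_nil. Qed.

(* Gaussian binomial coefficients, through
   1 - q^(a+b) = (1 - q^a) + q^a (1 - q^b) *)
Lemma qpochD (A : comNzRingType) a b :
  exists g, qpoch A (a + b) = g * (qpoch A a * qpoch A b).
Proof.
have [N leN] := ubnP (a + b); elim: N a b leN => // N IH [|a] [|b] leN.
- by exists 1; rewrite qpoch0 !mulr1.
- by exists 1; rewrite qpoch0 !mul1r.
- by exists 1; rewrite qpoch0 addn0 mulr1 mul1r.
have [g1 e1] := IH a b.+1 ltac:(lia); have [g2 e2] := IH a.+1 b ltac:(lia).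
exists (g1 + 'X^(a.+1) * g2); rewrite addnS qpochS.
have -> : 1 - 'X^((a.+1 + b).+1) = (1 - 'X^(a.+1)) + 'X^(a.+1) * (1 - 'X^(b.+1)) :> {poly A}.
  by rewrite -addnS exprD mulrBr mulr1 addrA subrK.
rewrite mulrDl {1}addSnnS e1 e2 [RHS]mulrDl !qpochS; congr (_ + _).
  by rewrite mulrCA -!mulrA.
rewrite -!mulrA; congr (_ * _); rewrite mulrCA; congr (_ * _).
by rewrite mulrCA; congr (_ * _); rewrite mulrCA.
Qed.

Lemma cyc_prod_dvd_qpoch (A : comNzRingType) s : all (leq 1) s ->
  exists g, qpoch A (sumn s) = g * cyc_prod A s.
Proof.
elim: s => [|a s IH] /=; first by exists 1; rewrite /cyc_prod big_nil qpoch0 mulr1.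
case/andP=> a0 /IH[g e]; have [h ->] := qpochD A a (sumn s).
exists (h * qpoch A a.-1 * g); rewrite e /cyc_prod big_cons -/(cyc_prod A s).
rewrite -(prednK a0) qpochS prednK // -!mulrA; congr (_ * _).
by rewrite mulrCA; congr (_ * _); rewrite mulrCA.
Qed.

Lemma map_cyc_prod (A B : comNzRingType) (f : {rmorphism A -> B}) s :
  map_poly f (cyc_prod A s) = cyc_prod B s.
Proof.
rewrite /cyc_prod rmorph_prod; apply: eq_bigr => l _.
by rewrite rmorphB rmorph1 /= map_polyXn.
Qed.

Lemma onemXn_factor (A : comNzRingType) n :
  1 - 'X^n = (1 - 'X) * \sum_(i < n) 'X^i :> {poly A}.
Proof. by rewrite -[LHS]opprB subrX1 -mulNr opprB. Qed.

Lemma geom_poly (A : comNzRingType) d j :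
  1 - 'X^(j * d) = (1 - 'X^d) * \sum_(i < j) 'X^(i * d) :> {poly A}.
Proof.
rewrite mulnC exprM -[LHS]opprB subrX1 -mulNr opprB.
by congr (_ * _); apply: eq_bigr => i _; rewrite mulnC exprM.
Qed.

(* 1 - q^l with its factor 1 - q^d removed when d divides l *)
Definition cyc_reduced (A : comNzRingType) d l : {poly A} :=
  if (d %| l)%N then \sum_(i < l %/ d) 'X^(i * d) else 1 - 'X^l.

Lemma cyc_reducedE (A : comNzRingType) d l :
  1 - 'X^l = (1 - 'X^d) ^+ (d %| l)%N * cyc_reduced A d l.
Proof.
rewrite /cyc_reduced; case: ifP => dl; last by rewrite mul1r.
by rewrite expr1 -geom_poly divnK.
Qed.

Lemma cyc_prod_reducedE (A : comNzRingType) d s :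
  cyc_prod A s =
    (1 - 'X^d) ^+ count (dvdn d) s * \prod_(l <- s) cyc_reduced A d l.
Proof.
rewrite /cyc_prod (eq_bigr _ (fun l _ => cyc_reducedE A d l)) big_split /=.
by congr (_ * _); elim: s => [|a s IH]; rewrite ?big_nil // big_cons IH exprD.
Qed.

Lemma count_dvdn_iota d n : (0 < d)%N -> count (dvdn d) (iota 1 n) = (n %/ d)%N.
Proof.
move=> d0; elim: n => [|n IH]; first by rewrite div0n.
by rewrite -[n.+1]addn1 iotaD count_cat IH /= addn0 addn1 add1n divnS // addnC.
Qed.

Variable F : numFieldType.
Implicit Types (K : {poly F}) (w : F).

Lemma horner_cyc_reduced d l w : d.-primitive_root w ->
  (cyc_reduced F d l).[w] = if (d %| l)%N then (l %/ d)%:R else 1 - w ^+ l.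
Proof.
move=> wd; rewrite /cyc_reduced; case: ifP => _; last by rewrite !hornerE.
rewrite horner_sum -[in RHS](card_ord (l %/ d)) -sumr_const.
by apply: eq_bigr => i _; rewrite hornerXn mulnC exprM (prim_expr_order wd) expr1n.
Qed.

Lemma horner_cyc_reduced_neq0 d s w : d.-primitive_root w -> all (leq 1) s ->
  \prod_(l <- s) (cyc_reduced F d l).[w] != 0.
Proof.
move=> wd s0; rewrite prodf_seq_neq0; apply/allP => l ls /=.
have l0 := allP s0 l ls.
rewrite (horner_cyc_reduced _ wd); case: ifP => dl.
  by rewrite pnatr_eq0 -lt0n divn_gt0 ?(prim_order_gt0 wd) //; apply: dvdn_leq.
by rewrite subr_eq0 eq_sym -(prim_order_dvd wd) dl.
Qed.

Lemma onemXn_neq0 d : (0 < d)%N -> 1 - 'X^d != 0 :> {poly F}.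
Proof. by move=> d0; rewrite -opprB oppr_eq0 -size_poly_eq0 size_XnsubC. Qed.

Lemma iota_gt0 n : all (leq 1) (iota 1 n).
Proof. by apply/allP => i; rewrite mem_iota => /andP[]. Qed.

Lemma horner_onemXn d w : d.-primitive_root w -> (1 - 'X^d).[w] = 0.
Proof. by move=> wd; rewrite !hornerE (prim_expr_order wd) subrr. Qed.

(** The two sides carry [1 - 'X^d] to the powers [count (dvdn d) s] and [n %/ d]; what remains of
    the two products after cancelling is nonzero at [w]. The factor [A] is general since both [1]
    and [1 - 'X] occur. *)
Lemma horner_cyc_quotient K A d w n s :
    d.-primitive_root w -> all (leq 1) s -> A.[w] != 0 ->
    K * cyc_prod F s = A * qpoch F n ->
  K.[w] * \prod_(l <- s) (cyc_reduced F d l).[w] =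
    if count (dvdn d) s == (n %/ d)%N
    then A.[w] * \prod_(l <- iota 1 n) (cyc_reduced F d l).[w] else 0.
Proof.
move=> wd s0 A0; have d0 := prim_order_gt0 wd.
rewrite /qpoch !(cyc_prod_reducedE F d) count_dvdn_iota //.
set L := \prod_(l <- s) _; set E := \prod_(l <- iota 1 n) _.
rewrite -!horner_prod -/L -/E; set c := count _ s; set k := (n %/ d)%N => e.
have cancel a (p q : {poly F}) :
    (1 - 'X^d) ^+ a * p = (1 - 'X^d) ^+ a * q -> p = q.
  by apply/mulfI/expf_neq0/onemXn_neq0.
case: (ltngtP c k) => ck.
- have /cancel : (1 - 'X^d) ^+ c * (K * L) =
      (1 - 'X^d) ^+ c * (A * ((1 - 'X^d) ^+ (k - c) * E)).
    by rewrite mulrCA e [RHS]mulrCA; congr (_ * _); rewrite mulrA -exprD subnKC // ltnW.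
  move/(congr1 (horner^~ w)); rewrite !hornerM !horner_exp horner_onemXn //.
  by rewrite expr0n subn_eq0 leqNgt ck /= mul0r mulr0.
(* An excess of factors on the left would force the right side, nonzero at [w], to vanish there. *)
- have /cancel : (1 - 'X^d) ^+ k * (K * ((1 - 'X^d) ^+ (c - k) * L)) =
      (1 - 'X^d) ^+ k * (A * E).
    by rewrite mulrCA [X in K * X]mulrA -exprD subnKC ?(ltnW ck) // e mulrCA.
  move/(congr1 (horner^~ w)); rewrite !hornerM !horner_exp horner_onemXn //.
  rewrite expr0n subn_eq0 leqNgt ck /= mul0r mulr0 => /eqP.
  rewrite eq_sym mulf_eq0 (negPf A0) /= /E horner_prod.
  by rewrite (negPf (horner_cyc_reduced_neq0 wd (iota_gt0 n))).
- have /cancel : (1 - 'X^d) ^+ k * (K * L) = (1 - 'X^d) ^+ k * (A * E).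
    by rewrite mulrCA -{1}ck e mulrCA.
  by move/(congr1 (horner^~ w)); rewrite !hornerM.
Qed.

Lemma qnum_factor n (z : F) : (0 < n)%N -> n.-primitive_root z ->
  \sum_(i < n) 'X^i = \prod_(1 <= i < n) ('X - (z ^+ i)%:P).
Proof.
move=> n0 zn; apply: (@mulfI _ ('X - 1)); first by rewrite -polyC1 polyXsubC_eq0.
rewrite -subrX1 -(factor_Xn_sub_1 zn) big_ltn //; by rewrite expr0 polyC1.
Qed.

Lemma prod_onem_prim d w : d.-primitive_root w ->
  \prod_(1 <= i < d) (1 - w ^+ i) = d%:R.
Proof.
move=> wd; have := qnum_factor (prim_order_gt0 wd) wd.
move/(congr1 (horner^~ 1)); rewrite horner_sum horner_prod.
have -> : \sum_(i < d) ('X^i).[1] = d%:R :> F.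
  rewrite -[in RHS](card_ord d) -sumr_const.
  by apply: eq_bigr => i _; rewrite hornerXn expr1n.
move=> ->.
by apply: eq_bigr => i _; rewrite hornerXsubC.
Qed.

(** A block of [d] consecutive indices contributes [d], from the factors [1 - w ^+ i] with 0 < i <
    d, times the quotient by [d] of the multiple of [d] that ends it. *)
Lemma prod_reduced_iota d w k : d.-primitive_root w -> (0 < d)%N ->
  \prod_(l <- iota 1 (k * d)) (cyc_reduced F d l).[w] = (k`! * d ^ k)%:R.
Proof.
move=> wd d0; elim: k => [|k IH]; first by rewrite big_nil.
rewrite mulSn addnC iotaD big_cat /= IH factS expnS add1n.
have -> : iota (k * d).+1 d = rcons (iota (k * d).+1 d.-1) (k.+1 * d)%N.
  by rewrite -[X in iota _ X = _](prednK d0) -[d.-1.+1]addn1 iotaD cats1; congr rcons; lia.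
rewrite -cats1 big_cat big_seq1 /= [X in _ * (X * _)](_ : _ = d%:R).
  by rewrite (horner_cyc_reduced _ wd) dvdn_mull // mulnK // -!natrM; congr _%:R; lia.
rewrite -(prod_onem_prim wd) /index_iota subn1 -[(k * d).+1]addn1 iotaDl big_map.
rewrite big_seq [RHS]big_seq; apply: eq_bigr => i; rewrite mem_iota => hi.
rewrite (horner_cyc_reduced _ wd) dvdn_addr ?dvdn_mull // gtnNdvd //; try lia.
by rewrite exprD mulnC exprM (prim_expr_order wd) expr1n mul1r.
Qed.

(** The quotient [G] of (q; q)_n by [cyc_prod F s] vanishes at all n-th roots of unity other than 1,
    so [n]_q divides it. Then [K] comes from (q; q)_n = (1 - q) [n]_q (q; q)_(n-1). *)
Lemma cyc_quotient_exists n (z : F) s : (0 < n)%N -> n.-primitive_root z ->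
    all (leq 1) s -> sumn s = n ->
    (forall d, 1 < d -> d %| n -> ~~ perm_eq s (nseq (n %/ d) d))%N ->
  exists K, K * cyc_prod F s = (1 - 'X) * qpoch F n.-1.
Proof.
move=> n0 zn s0 sn H; have [G] := cyc_prod_dvd_qpoch F s0.
rewrite sn => eG.
have qn0 : \sum_(i < n) 'X^i != 0 :> {poly F}.
  rewrite (qnum_factor n0 zn) prodf_seq_neq0; apply/allP => i _ /=.
  by rewrite polyXsubC_eq0.
have /uniq_roots_prod_XsubC : all (root G) [seq z ^+ i | i <- index_iota 1 n].
  apply/allP => _ /mapP[i + ->]; rewrite mem_index_iota => /andP[i0 i_n].
  have wd := exp_prim_root zn i; set d := (n %/ _)%N in wd.
  have dn : (d %| n)%N by apply/dvdn_div/dvdn_gcdr.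
  have d1 : (1 < d)%N.
    rewrite ltn_neqAle (prim_order_gt0 wd) andbT eq_sym.
    apply/eqP => d1; move: wd; rewrite d1 => /prim_expr_order/eqP.
    by rewrite expr1 -(prim_order_dvd zn) gtnNdvd.
  have := horner_cyc_quotient (K := G) (A := 1) (n := n) wd s0.
  rewrite hornerC oner_eq0 mul1r => /(_ isT (esym eG)).
  (* A nonzero value needs [n %/ d] parts divisible by [d], which then exhaust the sum and all equal
     [d]. *)
  rewrite /root; case: eqP => [/esym cs|_ /eqP].
    have : perm_eq s (nseq (n %/ d) d).
      by rewrite -sn; apply: count_dvdn_full; rewrite ?sn // ltnW.
    by rewrite (negPf (H d d1 dn)).
  by rewrite mulf_eq0 (negPf (horner_cyc_reduced_neq0 wd s0)) orbF.
case=> [|q eq].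
  rewrite uniq_rootsE map_inj_in_uniq ?iota_uniq // => i j.
  rewrite !mem_index_iota => /andP[_ hi] /andP[_ hj] /eqP.
  by rewrite (eq_prim_root_expr zn) !modn_small // => /eqP.
rewrite big_map -(qnum_factor n0 zn) in eq.
exists q; apply: (mulIf qn0).
by rewrite mulrAC -eq -eG -{1}(prednK n0) qpochS prednK // mulrAC -onemXn_factor.
Qed.

(** The factor [(1 - w) ^+ r] cancels: on the left it comes from the [r] parts 1, on the right from
    [1 - 'X] and the [r.-1] indices beyond [k * d]. *)
Lemma horner_cyc_quotient_semiregular K d k r w s :
    d.-primitive_root w -> (1 < d)%N -> (0 < r <= 2)%N ->
    perm_eq s (nseq k d ++ nseq r 1%N) ->
    K * cyc_prod F s = (1 - 'X) * qpoch F (k * d + r).-1 ->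
  K.[w] = (k`! * d ^ k)%:R.
Proof.
move=> wd d1 r2 ps e.
have w1 : 1 - w != 0.
  by rewrite subr_eq0 eq_sym -[w]expr1 -(prim_order_dvd wd) gtnNdvd.
have s0 : all (leq 1) s.
  by rewrite (perm_all _ ps) all_cat !all_nseq; lia.
have := horner_cyc_quotient wd s0 _ e; rewrite !hornerE => /(_ w1).
rewrite (seq.permP ps) count_cat !count_nseq dvdnn dvdn1 mul1n.
have -> : (d == 1)%N = false by lia.
rewrite mul0n addn0 (_ : ((_ + _).-1 %/ d)%N = k) ?eqxx; last first.
  have -> : (k * d + r).-1 = (k * d + r.-1)%N by lia.
  by rewrite divnMDl ?(ltnW d1) // divn_small ?addn0 //; lia.
rewrite (perm_big _ ps) big_cat !big_nseq !iter_mulr_1.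
have -> : (k * d + r).-1 = (k * d + r.-1)%N by lia.
rewrite iotaD big_cat /= (prod_reduced_iota _ wd (ltnW d1)).
rewrite !(horner_cyc_reduced _ wd) dvdnn divnn (ltnW d1) expr1n mul1r.
rewrite dvdn1 ifN; last by lia.
have -> : \prod_(l <- iota (1 + k * d) r.-1) (cyc_reduced F d l).[w] = (1 - w) ^+ r.-1.
  case: r r2 {ps e} => [|[|[|r]]] // _; rewrite /= ?big_nil ?big_seq1 //.
  rewrite (horner_cyc_reduced _ wd) ifN; last first.
    by rewrite dvdn_addl ?dvdn_mull // dvdn1; lia.
  by rewrite exprD mulnC exprM (prim_expr_order wd) expr1n mulr1 !expr1.
rewrite mulrCA -exprS prednK; last by lia.
by apply/mulIf/expf_neq0.
Qed.

Lemma horner_cyc_quotient_eq0 K d n w s :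
    d.-primitive_root w -> (1 < d)%N -> all (leq 1) s ->
    K * cyc_prod F s = (1 - 'X) * qpoch F n ->
  count (dvdn d) s != (n %/ d)%N -> K.[w] = 0.
Proof.
move=> wd d1 s0 e ck.
have w1 : (1 - 'X).[w] != 0.
  by rewrite !hornerE subr_eq0 eq_sym -[w]expr1 -(prim_order_dvd wd) gtnNdvd.
have /eqP := horner_cyc_quotient wd s0 w1 e.
by rewrite (negPf ck) mulf_eq0 (negPf (horner_cyc_reduced_neq0 wd s0)) orbF => /eqP.
Qed.

(** As [1 - 'X] vanishes at 1, it cannot serve as [A] in [horner_cyc_quotient]. Multiplying by
    [1 - 'X^n] and cancelling [1 - 'X] replaces [A] by 1 and [K] by [K] times [n]_q, whose value [n]
    at 1 turns n! into (n - 1)!. *)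
Lemma horner_cyc_quotient1 K n s : (0 < n)%N ->
    all (leq 1) s -> sumn s = n ->
    K * cyc_prod F s = (1 - 'X) * qpoch F n.-1 ->
  K.[1] = (if s == nseq n 1%N then (n.-1)`!%:R else 0).
Proof.
move=> n0 s0 sn e.
have w1 : 1.-primitive_root (1 : F) by apply/forallP => i; rewrite ord1 unity_rootE expr1n eqxx.
have e' : (K * (1 - 'X^n)) * cyc_prod F s = (1 - 'X) * qpoch F n.
  by rewrite -[in RHS](prednK n0) qpochS prednK // mulrAC e -mulrA [qpoch _ _ * _]mulrC.
have /mulfI e2 : (1 - 'X : {poly F}) != 0 by apply: (onemXn_neq0 (d := 1)).
have {e'}e' : (K * \sum_(i < n) 'X^i) * cyc_prod F s = 1 * qpoch F n.
  apply: e2; rewrite mul1r -e'.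
  by rewrite onemXn_factor mulrA; congr (_ * _); rewrite mulrCA.
have := horner_cyc_quotient w1 s0 _ e'; rewrite hornerC oner_eq0 => /(_ isT).
rewrite hornerM horner_sum.
have -> : \sum_(i < n) ('X^i).[1] = n%:R :> F.
  rewrite -[in RHS](card_ord n) -sumr_const.
  by apply: eq_bigr => i _; rewrite hornerXn expr1n.
rewrite divn1 mul1r.
rewrite (eq_count (a2 := predT)) ?count_predT => [|x]; last by rewrite dvd1n.
have -> : iota 1 n = iota 1 (n * 1) by rewrite muln1.
rewrite prod_reduced_iota // exp1n muln1.
have nn : n%:R != 0 :> F by rewrite pnatr_eq0 -lt0n.
case: eqP => [ss|ns] e3.
  have es := all_leq1_nseq s0; rewrite sn ss in es.
  rewrite {1}es // eqxx; move: e3; rewrite es // big_nseq iter_mulr_1.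
  rewrite (horner_cyc_reduced _ w1) dvd1n divn1 expr1n mulr1.
  by rewrite -[in RHS](prednK n0) factS prednK // natrM mulrC => /(mulfI nn).
rewrite ifN; last by apply/eqP => es; apply: ns; rewrite es size_nseq.
move/eqP: e3; rewrite !mulf_eq0 (negPf nn) orbF.
by rewrite (negPf (horner_cyc_reduced_neq0 w1 s0)) orbF => /eqP.
Qed.

End Cyclotomic.

(** * Hilbert series of invariants *)

Section GeneratingFunctions.
Variable A : comNzRingType.

Lemma coef_sumXn (I : finType) (P : pred I) (g : I -> nat) k :
  (\sum_(f | P f) 'X^(g f) : {poly A})`_k = #|[set f | P f && (g f == k)]|%:R.
Proof.
rewrite coef_sum cardE -sum1_size big_enum_cond /= natr_sum.
rewrite [RHS](eq_bigl (fun f => P f && (g f == k))) => [|f]; last by rewrite inE andbT.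
by rewrite big_mkcondr; apply: eq_bigr => f _; rewrite coefXn eq_sym; case: eqP.
Qed.

Lemma prod_geom_ffun (J : finType) (w : J -> nat) N :
  \prod_j \sum_(i < N) 'X^(i * w j) =
    \sum_(f : {ffun J -> 'I_N}) 'X^(\sum_j f j * w j) :> {poly A}.
Proof.
by rewrite bigA_distr_bigA; apply: eq_bigr => f _; rewrite prodrXr.
Qed.

Lemma prod_onem_mod (J : finType) (w : J -> nat) N : (forall j, 0 < w j)%N ->
  exists r, \prod_j (1 - 'X^(N * w j)) = 1 + 'X^N * r :> {poly A}.
Proof.
move=> w0; elim/big_rec: _ => [|j y _ [r ->]]; first by exists 0; rewrite mulr0 addr0.
exists (r - 'X^(N * (w j).-1) * (1 + 'X^N * r)).
rewrite -{1}(prednK (w0 j)) mulnS exprD.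
ring.
Qed.

(** The sum is a product of geometric series cut off after [N] terms. Times the factors
    [1 - 'X^(w j)] it is 1 modulo q^N, so it stands for the inverse power series in coefficients
    below [N]. *)
Lemma coef_mul_geom (J : finType) (w : J -> nat) N k (q : {poly A}) :
    (forall j, 0 < w j)%N -> (k < N)%N ->
  ((\sum_(f : {ffun J -> 'I_N}) 'X^(\sum_j f j * w j)) *
    \prod_j (1 - 'X^(w j)) * q)`_k = q`_k.
Proof.
move=> w0 kN; rewrite -prod_geom_ffun -big_split /=.
have [r e] := prod_onem_mod N w0.
rewrite (eq_bigr (fun j => 1 - 'X^(N * w j))) => [|j _].
  by rewrite e mulrDl mul1r coefD -mulrA coefXnM kN addr0.
by rewrite mulrC -geom_poly.
Qed.

End GeneratingFunctions.

Section FixedFunctions.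
Variables (n N : nat).
Local Notation T := {ffun 'I_n -> 'I_N}.

(** Exponent vectors with entries below [N] form a finite type that contains all monomials of degree
    below [N]. The inverse makes this a right action. *)
Definition ffun_perm (f : T) (s : 'S_n) : T := [ffun i => f (s^-1 i)%g].

Lemma ffun_perm_is_action : is_action [set: 'S_n] ffun_perm.
Proof.
apply: is_total_action => [f|f s t]; apply/ffunP => i; rewrite !ffunE.
  by rewrite invg1 perm1.
by rewrite invMg permM.
Qed.

Definition ffun_act := Action ffun_perm_is_action.

(** A function fixed by [h] is constant on the cycles of [h], hence a function on the set [J] of
    cycles, where each value counts with the length of its cycle. *)
Lemma sum_fixed_ffun (A : comNzRingType) (h : 'S_n) :
  exists (J : finType) (w : J -> nat),
  [/\ forall j, (0 < w j)%N,
      \prod_j (1 - 'X^(w j)) =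
        cyc_prod A [seq #|pred_of_set B| | B <- enum (porbits h)]
    & \sum_(f : {ffun J -> 'I_N}) 'X^(\sum_j f j * w j) =
      \sum_(f : T | f \in 'Fix_ffun_act[h]%g) 'X^(\sum_i f i) :> {poly A}].
Proof.
pose J : finType := 'I_#|porbits h|.
have PO i : porbit h i \in porbits h by apply: imset_f.
pose idx (i : 'I_n) : J := enum_rank_in (PO i) (porbit h i).
have idxE i : enum_val (idx i) = porbit h i by rewrite enum_rankK_in.
have memE (j : J) (i : 'I_n) : (i \in (enum_val j : {set 'I_n})) = (idx i == j).
  have /imsetP[x _ e] := enum_valP j; rewrite e -eq_porbit_mem -idxE -e.
  by rewrite (inj_eq enum_val_inj).
have [rep repK] : exists rep : J -> 'I_n, forall j, idx (rep j) = j.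
  apply: (fin_all_exists (P := fun j x => idx x = j)) => j; have /imsetP[x _ e] := enum_valP j.
  by exists x; apply/eqP; rewrite -memE e porbit_id.
exists J, (fun j => #|(enum_val j : {set 'I_n})|); split.
- by move=> j; apply/card_gt0P; exists (rep j); rewrite memE repK.
- by rewrite /cyc_prod big_map big_enum [RHS]big_enum_val.
pose F (p : {ffun J -> 'I_N}) : T := [ffun i => p (idx i)].
pose G (f : T) : {ffun J -> 'I_N} := [ffun j => f (rep j)].
rewrite [RHS](reindex_onto F G) => [|f fh].
  rewrite [RHS](eq_bigl predT) => [|p]; last first.
    have -> : G (F p) = p by apply/ffunP => j; rewrite !ffunE repK.
    rewrite eqxx andbT; apply/afix1P/ffunP => i; rewrite /= !ffunE; congr (p _).
    by apply/eqP; rewrite -memE idxE -porbitV; apply: (mem_porbit _ 1).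
  apply: eq_bigr => p _; congr 'X^_.
  rewrite (partition_big idx predT) //=; apply: eq_bigr => j _.
  rewrite (eq_bigr (fun=> p j : nat)) => [|i /eqP <-]; last by rewrite ffunE.
  rewrite sum_nat_const mulnC; congr (_ * _)%N.
  by apply: eq_card => i; rewrite memE.
apply/ffunP => i; rewrite !ffunE.
have fix1 x : f (h x) = f x.
  have /afix1P/ffunP/(_ (h x)) := fh; by rewrite ffunE permK.
have /porbitP[k ->] : rep (idx i) \in porbit h i by rewrite -idxE memE repK.
elim: k => [|k IH]; first by rewrite perm1.
by rewrite expgSr permM fix1.
Qed.

End FixedFunctions.

(** * Bases of invariant forms *)

Section Dimension.

Lemma dim_basis_family (F : fieldType) (V : vectType F) (I : finType)
    (S : {set I}) (b : I -> V) (U : {vspace V}) :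
    (forall i, i \in S -> b i \in U) ->
    (forall v, v \in U -> exists c : I -> F, v = \sum_(i in S) c i *: b i) ->
    (forall c : I -> F, \sum_(i in S) c i *: b i = 0 ->
       forall i, i \in S -> c i = 0) ->
  \dim U = #|S|.
Proof.
move=> bU span_b free_b; pose X := [tuple b (enum_val i) | i < #|S|].
have tX (i : 'I_#|S|) : X`_i = b (enum_val i).
  by rewrite -tnth_nth tnth_mktuple.
suff /andP[/eqP <- fX] : basis_of U X.
  by move: fX; rewrite /free size_tuple => /eqP.
apply/andP; split.
  rewrite eqEsubv; apply/andP; split.
    apply/span_subvP => v /tnthP[i ->]; rewrite tnth_mktuple.
    exact/bU/enum_valP.
  apply/subvP => v /span_b[c ->]; rewrite big_enum_val /=.
  apply: memv_suml => i _; apply/memvZ/memv_span.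
  by rewrite -tX mem_nth // size_tuple.
apply/freeP => k e i.
have [x Sx] : exists x, x \in S by exists (enum_val i); apply: enum_valP.
pose c y := k (enum_rank_in Sx y).
have cE j : c (enum_val j) = k j by rewrite /c enum_valK_in.
rewrite -cE; apply: free_b (enum_valP i).
rewrite big_enum_val /= -[RHS]e; apply: eq_bigr => j _.
by rewrite cE tX.
Qed.

Variables (n N : nat).
Local Notation T := {ffun 'I_n -> 'I_N}.

Definition mon (f : T) : 'X_{1..n} := [multinom (f i : nat) | i < n].

Lemma mon_inj : injective mon.
Proof.
by move=> f g /mnmP e; apply/ffunP => i; apply/val_inj; have := e i; rewrite !mnmE.
Qed.

Lemma mdeg_mon f : mdeg (mon f) = (\sum_i f i)%N.
Proof. by rewrite mdegE; apply: eq_bigr => i _; rewrite mnmE. Qed.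

Lemma mon_perm f (s : 'S_n) : mon (ffun_perm f s) = [multinom mon f ((s^-1)%g i) | i < n].
Proof. by apply/mnmP => i; rewrite !mnmE ffunE. Qed.

Variable F : fieldType.

Lemma mcoeff_sum_mon (S : {set T}) (c : T -> F) f : f \in S ->
  (\sum_(g in S) c g *: 'X_[mon g])@_(mon f) = c f.
Proof.
move=> Sf; rewrite raddf_sum (bigD1 f) //= mcoeffZ mcoeffX eqxx mulr1.
rewrite big1 ?addr0 // => g /andP[_ gf].
by rewrite mcoeffZ mcoeffX (inj_eq mon_inj) (negPf gf) mulr0.
Qed.

(** [mf] will be the degree, or the weight used for polynomials in the elementary symmetric ones.
    Both bound every exponent. *)
Lemma homog_sum_mon (mf : measure n) d (p : {mpoly F[n]}) :
    (forall (m : 'X_{1..n}) i, m i <= mf m)%N -> (d < N)%N ->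
    p \is d.-homog for mf ->
  p = \sum_(g in [set f : T | mf (mon f) == d]) p@_(mon g) *: 'X_[mon g].
Proof.
move=> mf_ge dN hp; set S := [set f | _].
have [N0 eN] : exists N0, N = N0.+1 by exists N.-1; rewrite prednK //; case: (N) dN.
apply/mpolyP => m; have [md|md] := eqVneq (mf m) d.
  have mN i : (m i < N)%N by apply: leq_ltn_trans dN; rewrite -md.
  pose f : T := [ffun i => Ordinal (mN i)].
  have em : m = mon f by apply/mnmP => i; rewrite mnmE ffunE.
  by rewrite {2}em mcoeff_sum_mon ?inE -?em ?md.
rewrite (dhomog_nemf_coeff hp md) raddf_sum big1 //= => g.
rewrite inE => /eqP gd; rewrite mcoeffZ mcoeffX.
by case: eqP => [e|_]; rewrite ?mulr0 //; move: md; rewrite -e gd eqxx.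
Qed.

Lemma mnm_le_mdeg (m : 'X_{1..n}) i : (m i <= mdeg m)%N.
Proof. by rewrite mdegE (bigD1 i) //= leq_addr. Qed.

Lemma mnm_le_mnmwgt (m : 'X_{1..n}) i : (m i <= mnmwgt m)%N.
Proof. by rewrite /mnmwgt (bigD1 i) //= mulnS -addnA leq_addr. Qed.

End Dimension.

Section Burnside.
Variables (n N d : nat) (F : fieldType) (H : {group 'S_n}).
Hypothesis dN : (d < N)%N.
Local Notation T := {ffun 'I_n -> 'I_N}.

Local Notation to := (ffun_act n N).
Let S : {set T} := [set f : T | mdeg (mon f) == d].
Let O := orbit to H @: S.

Definition to_form (p : {mpoly F[n]}) : Defs.form n F d := insubd (0 : Defs.form n F d) p.

Lemma val_form_comb (I : finType) (P : {set I}) (c : I -> F)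
    (b : I -> Defs.form n F d) :
  val (\sum_(i in P) c i *: b i) = \sum_(i in P) c i *: val (b i).
Proof. by apply: (big_morph val). Qed.

Lemma val_to_form p : p \is d.-homog -> val (to_form p) = p.
Proof. by move=> hp; rewrite /to_form val_insubd hp. Qed.

Let actsS : [acts H, on S | ffun_act n N].
Proof.
apply/subsetP => s Hs; rewrite !inE; apply/subsetP => f; rewrite !inE /=.
by rewrite mon_perm mdeg_mperm.
Qed.

Let homogX f : f \in S -> 'X_[F, mon f] \is d.-homog.
Proof. by rewrite inE dhomogX. Qed.

Let orbit_sub o : o \in O -> o \subset S.
Proof. by case/imsetP => f Sf ->; rewrite acts_sub_orbit. Qed.

Let osum (o : {set T}) : {mpoly F[n]} := \sum_(f in o) 'X_[mon f].

Let homog_osum o : o \in O -> osum o \is d.-homog.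
Proof.
by move=> /orbit_sub /subsetP oS; apply: rpred_sum => f /oS; apply: homogX.
Qed.

Let osum_comb (c : {set T} -> F) :
  \sum_(o in O) c o *: osum o =
    \sum_(f in S) c (orbit to H f) *: 'X_[mon f].
Proof.
rewrite (partition_big_imset (orbit to H)) /= -/O.
apply: eq_bigr => o Oo; rewrite scaler_sumr.
have /subsetP oS := orbit_sub Oo.
have [f Sf eo] := imsetP Oo.
have mem_o g : (g \in o) = (orbit to H g == o).
  by rewrite eo -orbit_eq_mem.
rewrite [LHS](eq_bigl (fun g => (g \in S) && (orbit to H g == o))).
  by apply: eq_bigr => g /andP[_ /eqP ->].
by move=> g; rewrite -mem_o; case: (boolP (g \in o)) => [/oS ->|]; rewrite ?andbF.
Qed.

(** The sums of monomials over [H]-orbits form a basis. *)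
Lemma dim_inv_form_orbits : \dim (inv_form F H d) = #|O|.
Proof.
apply: (dim_basis_family (b := fun o => to_form (osum o))).
- move=> o Oo; apply/inv_formP => s Hs; rewrite val_to_form ?homog_osum //.
  rewrite /osum raddf_sum /=; have [f Sf eo] := imsetP Oo.
  rewrite [RHS](reindex_inj (act_inj to s)) /=.
  apply: eq_big => [g|g _]; last by rewrite msymX mon_perm.
  by rewrite eo -!orbit_eq_mem orbit_act.
- move=> p /inv_formP ip.
  (* By invariance the coefficient is constant on an orbit, so any monomial of it may be picked. The
     default of [odflt] is never reached on an orbit. *)
  exists (fun o : {set T} => (val p)@_(mon (odflt [ffun=> Ordinal dN] [pick f in o]))).
  apply/val_inj; rewrite val_form_comb.
  under eq_bigr => o Oo do rewrite val_to_form ?homog_osum //.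
  rewrite (osum_comb (fun o => _)).
  rewrite {1}(homog_sum_mon (N := N) (@mnm_le_mdeg n) dN (valP p)).
  apply: eq_bigr => f Sf; congr (_ *: _).
  case: pickP => [g|/(_ f)]; last by rewrite /= orbit_refl.
  case/orbitP => s Hs <-; rewrite /= mon_perm -mcoeff_sym ip //.
  by rewrite groupV.
- move=> c /(congr1 val); rewrite val_form_comb.
  under eq_bigr => o Oo do rewrite val_to_form ?homog_osum //.
  rewrite osum_comb => e o /imsetP[f Sf ->].
  by rewrite -(mcoeff_sum_mon (fun f => c (orbit _ H f)) Sf) e mcoeff0.
Qed.

(** The Cauchy-Frobenius count of orbits on monomials: Molien's formula, coefficient by coefficient.
    The factor [#|H|] stays on the left to avoid division in [A]. *)
Lemma dim_inv_form (A : comNzRingType) :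
  ((#|H| * \dim (inv_form F H d))%N%:R : A) =
    \sum_(h in H)
      (\sum_(f : T | f \in 'Fix_to[h]%g) 'X^(\sum_i f i))`_d.
Proof.
rewrite dim_inv_form_orbits mulnC -(Frobenius_Cauchy actsS) natr_sum.
apply: eq_bigr => h Hh; rewrite coef_sumXn; congr (_%:R).
apply: eq_card => f; rewrite !inE mdeg_mon andbC; congr (_ && _).
Qed.

(** By the fundamental theorem the monomials in the elementary symmetric polynomials form a basis;
    [mnmwgt] records their degrees. *)
Lemma dim_sym_form :
  \dim (inv_form F [set: 'S_n] d) = #|[set f : T | mnmwgt (mon f) == d]|.
Proof.
set W := [set f | _].
pose E := [tuple mesym n F i.+1 | i < n].
have hE f : f \in W -> 'X_[mon f] \mPo E \is d.-homog.
  by rewrite inE => /eqP <-; apply: dhomog_XS.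
apply: (dim_basis_family (b := fun f => to_form ('X_[mon f] \mPo E))).
- move=> f Wf; apply/inv_formP => s _; rewrite val_to_form ?hE //.
  apply/issymP; rewrite comp_mpolyX; apply: rpred_prod => i _.
  by rewrite tnth_mktuple; apply/rpredX/mesym_sym.
- move=> p /inv_formP ip.
  have [|t [tE tp]] := sym_fundamental_homog _ (valP p).
    by apply/issymP => s; apply: ip; rewrite inE.
  exists (fun f => t@_(mon f)); apply/val_inj; rewrite val_form_comb.
  under eq_bigr => f Wf do rewrite val_to_form ?hE //.
  rewrite -tE {1}(homog_sum_mon (N := N) (@mnm_le_mnmwgt n) dN tp).
  by rewrite raddf_sum; apply: eq_bigr => f _; rewrite /= comp_mpolyZ.
- move=> c /(congr1 val); rewrite val_form_comb.
  under eq_bigr => f Wf do rewrite val_to_form ?hE //.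
  move=> e f Wf; rewrite -(mcoeff_sum_mon c Wf).
  suff -> : \sum_(g in W) c g *: 'X_[mon g] = 0 :> {mpoly F[n]} by rewrite mcoeff0.
  apply: msym_fundamental_un0; rewrite -[RHS]e raddf_sum.
  by apply: eq_bigr => g _; rewrite /= comp_mpolyZ.
Qed.

End Burnside.

(** * Hilbert series and their polynomial numerators *)

Section PowerSeries.

Lemma fps_mul_polyE (p : {poly int}) (f : fps) N k : (k < N)%N ->
  fps_mul (fps_poly p) f k = (p * \poly_(i < N) f i)`_k.
Proof.
move=> kN; rewrite coefM; apply: eq_bigr => i _; rewrite coef_poly.
by rewrite (leq_ltn_trans (leq_subr _ _) kN).
Qed.

Lemma poly_eq_mod (A : comNzRingType) (p q : {poly A}) N :
  (forall j, (j < N)%N -> p`_j = q`_j) -> exists r, p = q + 'X^N * r.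
Proof.
move=> e; exists (drop_poly N (p - q)).
rewrite mulrC -{1}[p](subrK q) addrC -{1}(poly_take_drop N (p - q)); congr (_ + _).
rewrite -[RHS]add0r; congr (_ + _); apply/polyP => j.
by rewrite coef_take_poly coef0 coefB; case: ltnP => // /e ->; rewrite subrr.
Qed.

(** Symmetric forms are counted by exponent vectors with weights 1, ..., n, whose generating
    function is 1 / (q; q)_n. The identity is read modulo q^N. *)
Lemma coef_qpoch_hilbert_sym (n : nat) (F : fieldType) N j : (j < N)%N ->
  (qpoch int n * \poly_(i < N) hilbert_series F [set: 'S_n] i)`_j = (1 : {poly int})`_j.
Proof.
move=> jN; pose w (i : 'I_n) := i.+1.
rewrite -(coef_mul_geom (w := w) 1 _ jN) // mulr1 (mulrC (\sum_(f : {ffun _ -> _}) _)).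
have -> : \prod_(i < n) (1 - 'X^(w i)) = qpoch int n.
  rewrite /qpoch /cyc_prod -[1%N]addn0 iotaDl big_map -val_enum_ord big_map.
  by rewrite big_enum.
rewrite !coefM; apply: eq_bigr => i _; congr (_ * _).
have iN : (j - i < N)%N by rewrite (leq_ltn_trans (leq_subr _ _) jN).
rewrite coef_poly iN /hilbert_series (dim_sym_form n F iN) coef_sumXn /=.
rewrite natz; congr (Posz _); apply: eq_card => f; rewrite !inE; congr (_ == _).
by apply: eq_bigr => l _; rewrite mnmE.
Qed.

(** Molien's formula multiplied by [Q]. The [K h] have coefficients in [E], but the left side is an
    integer series, and it ends where the sum of the [K h] does, so it is an integer polynomial. *)
Lemma hilbert_numerator (n : nat) (F : fieldType) (H : {group 'S_n})
    (E : numFieldType) (Q : {poly int}) (K : 'S_n -> {poly E}) :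
    (forall h, h \in H ->
       K h * cyc_prod E [seq #|pred_of_set B| | B <- enum (porbits h)] =
         map_poly intr Q) ->
  exists Y : {poly int},
    fps_mul (fps_poly Q) (hilbert_series F H) =1 fps_poly Y /\
    #|H|%:R *: map_poly intr Y = \sum_(h in H) K h.
Proof.
move=> eK; pose y := fps_mul (fps_poly Q) (hilbert_series F H).
have H0 : #|H|%:R != 0 :> E by rewrite pnatr_eq0 -lt0n cardG_gt0.
have ey k : #|H|%:R * (y k)%:~R = (\sum_(h in H) K h)`_k :> E.
  pose to := ffun_act n k.+1.
  pose G h : {poly E} :=
    \sum_(f : {ffun 'I_n -> 'I_k.+1} | f \in 'Fix_to[h]%g) 'X^(\sum_i f i).
  have -> : #|H|%:R * (y k)%:~R = \sum_(h in H) (map_poly intr Q * G h)`_k :> E.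
    under eq_bigr do rewrite coefM.
    rewrite exchange_big rmorph_sum mulr_sumr /=; apply: eq_bigr => i _.
    rewrite -mulr_sumr rmorphM /= mulrCA coef_map; congr (_ * _).
    have lt : (k - i < k.+1)%N by rewrite ltnS leq_subr.
    by rewrite /hilbert_series -pmulrn -natrM; apply: dim_inv_form.
  rewrite coef_sum; apply: eq_bigr => h Hh.
  have [J [w [w0 ew eG]]] := sum_fixed_ffun k.+1 E h.
  rewrite /G -eG; set G' := \sum_(f : {ffun _ -> _}) _; rewrite -(eK h Hh) -ew.
  rewrite -[RHS](coef_mul_geom (K h) w0 (ltnSn k)).
  by rewrite [K h * _]mulrC [_ * G' in LHS]mulrC mulrA.
have y0 k : (size (\sum_(h in H) K h)%R <= k)%N -> y k = 0.
  move=> kM; have /eqP := ey k; rewrite nth_default // mulf_eq0 (negPf H0) /=.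
  by rewrite intr_eq0 => /eqP.
exists (\poly_(k < size (\sum_(h in H) K h)) y k); split.
  by move=> k; rewrite /fps_poly coef_poly; case: ltnP => // /y0.
apply/polyP => k; rewrite coefZ coef_map coef_poly -ey.
by case: ltnP => // /y0 ->.
Qed.

(** [Y] is [Q] times the series of [H], and [P * Q] is inverse to the series of the full symmetric
    group. For the coefficient [k] the computation takes place in polynomials modulo q^(k+1). *)
Lemma hilbert_quotient (n : nat) (F : fieldType) (H : {group 'S_n})
    (Q P Y : {poly int}) :
    P * Q = qpoch int n ->
    fps_mul (fps_poly Q) (hilbert_series F H) =1 fps_poly Y ->
  fps_mul (fps_poly (P * Y)) (hilbert_series F [set: 'S_n]) =1
    hilbert_series F H.
Proof.
move=> PQ eY k; rewrite (fps_mul_polyE _ _ (ltnSn k)).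
set PS := \poly_(i < _) _; pose PH := \poly_(i < k.+1) hilbert_series F H i.
have [r er] := poly_eq_mod (fun j => @coef_qpoch_hilbert_sym n F k.+1 j).
have [r' er'] : exists r, Y = Q * PH + 'X^(k.+1) * r.
  apply: poly_eq_mod => j jk; rewrite -fps_mul_polyE //; exact/esym/eY.
have -> : P * Y * PS = PH + 'X^(k.+1) * (r * PH + P * r' * PS).
  rewrite er' -/PS in er *.
  have -> : P * (Q * PH + 'X^(k.+1) * r') * PS =
    (P * Q * PS) * PH + 'X^(k.+1) * (P * r' * PS) by ring.
  by rewrite PQ er; ring.
by rewrite coefD coefXnM ltnSn addr0 coef_poly ltnSn.
Qed.

End PowerSeries.

(** * Cyclic sieving *)

Lemma zetaX (R : realType) (m k : nat) :
  zeta R m ^+ k =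
    (cos (k%:R * (2 * pi / m%:R)) +i* sin (k%:R * (2 * pi / m%:R)))%C.
Proof.
elim: k => [|k IH]; first by rewrite !mul0r cos0 sin0.
rewrite exprSr IH /zeta; set a := 2 * pi / m%:R.
rewrite -(natr1 k) mulrDl mul1r cosD sinD.
by apply/eqP; rewrite eq_complex /= eqxx addrC eqxx.
Qed.

Lemma zeta_prim (R : realType) (m : nat) : (0 < m)%N ->
  m.-primitive_root (zeta R m).
Proof.
move=> m0; have mR : m%:R != 0 :> R by rewrite pnatr_eq0 -lt0n.
rewrite /primitive_root_of_unity m0; apply/forallP => i; apply/eqP.
rewrite unity_rootE zetaX; have [->|im] := eqVneq i.+1 m.
  have -> : m%:R * (2 * pi / m%:R) = pi *+ 2 :> R by rewrite mulrCA divff // mulr1 mulr_natl.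
  by rewrite cos2pi sin2pi eqxx.
apply/negbTE; rewrite eq_complex /= negb_and; apply/orP; left.
have lim : (i.+1 < m)%N by rewrite ltn_neqAle im ltn_ord.
(* Half the angle lies strictly between 0 and pi, where the sine is positive; so the cosine of the
   angle, 1 - 2 sin^2 y, is not 1. *)
set y := i.+1%:R * (pi / m%:R) : R.
have -> : i.+1%:R * (2 * pi / m%:R) = y *+ 2 :> R by rewrite /y -mulr_natl; ring.
have sy : 0 < sin y.
  apply: sin_gt0_pi; rewrite /y mulr_gt0 ?ltr0n ?divr_gt0 ?pi_gt0 ?ltr0n //=.
  rewrite mulrCA gtr_pMr ?pi_gt0 // ltr_pdivrMr ?ltr0n // mul1r ltr_nat.
  exact: lim.
rewrite cos_mulr2n cos2sin2; apply/eqP => e.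
have : sin y ^+ 2 = 0.
  have : (1 - sin y ^+ 2) *+ 2 - 1 = 1 - sin y ^+ 2 *+ 2 by ring.
  rewrite e => /eqP; rewrite eq_sym subr_eq addrC -subr_eq subrr eq_sym mulrn_eq0 /=.
  by move/eqP.
by move/eqP; rewrite expf_eq0 /= => /eqP e0; rewrite e0 ltxx in sy.
Qed.

Section LongCycle.
Variable n : nat.

Lemma long_cycleX k (i : 'I_n) :
  (long_cycle n ^+ k)%g i = ((i + k) %% n)%N :> nat.
Proof.
elim: k => [|k IH]; first by rewrite perm1 addn0 modn_small.
by rewrite expgSr permM permE /= IH -addn1 modnDml addn1 addnS.
Qed.

Lemma long_cycle_regular c (i : 'I_n) :
  c \in <[long_cycle n]>%g -> c i = i -> c = 1%g.
Proof.
case/cycleP => k -> /(congr1 val) /=; rewrite long_cycleX => e.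
apply/permP => j; apply/val_inj; rewrite /= long_cycleX perm1.
have kn : (k = 0 %[mod n])%N.
  by apply/eqP; rewrite -(eqn_modDl i) addn0 e modn_small.
by rewrite -modnDmr kn mod0n addn0 modn_small.
Qed.

Lemma long_cycle_trans (i j : 'I_n) :
  exists2 c, c \in <[long_cycle n]>%g & c i = j.
Proof.
exists (long_cycle n ^+ (n - i + j))%g; first exact: mem_cycle.
apply/val_inj; rewrite /= long_cycleX addnA subnKC ?(ltnW (ltn_ord i)) //.
by rewrite modnDl modn_small.
Qed.

End LongCycle.

(** Reduces to natural exponents: both [t] and the root of unity have their power [#[t].-1] as
    inverse. *)
Lemma expgz_zeta (R : realType) (gT : finGroupType) (t : gT) (b : int) :
  exists k, expgz t b = (t ^+ k)%g /\ zeta R #[t]%g ^ b = zeta R #[t]%g ^+ k.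
Proof.
case: b => k; first by exists k.
exists (#[t]%g.-1 * k.+1)%N; rewrite /= expgM exprM; split.
  rewrite -expgVn; congr (_ ^+ _)%g.
  by apply/eqP; rewrite eq_invg_mul -expgS prednK ?order_gt0 // expg_order.
have := prim_expr_order (zeta_prim R (order_gt0 t)).
rewrite -(prednK (order_gt0 t)) /= exprS => e.
by rewrite NegzE -exprnN -exprVn (mulr1_eq e).
Qed.

(** * Values of the numerator at 1 and at primitive roots of unity *)

Section Numerator.
Variables (F : numFieldType) (n : nat) (H : {group 'S_n}) (K : 'S_n -> {poly F}).
Hypothesis n0 : (0 < n)%N.
Hypothesis eK : forall h, h \in H ->
  K h * cyc_prod F (cycle_lens h) = (1 - 'X) * qpoch F n.-1.

Let sumn_lens (h : 'S_n) : sumn (cycle_lens h) = n.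
Proof. by rewrite sumn_cycle_lens card_ord. Qed.

Lemma sum_quotients_at1 : (\sum_(h in H) K h).[1] = ((n.-1)`!)%:R.
Proof.
rewrite horner_sum (bigD1 1%g) ?group1 //= big1 => [|h /andP[Hh h1]].
  rewrite addr0 (horner_cyc_quotient1 n0 (cycle_lens_gt0 _) (sumn_lens _) (eK (group1 H))).
  have [//|x|ps _] := @cycle_lens_const _ (1%g : 'S_n) 1%N.
    by apply/eqP; rewrite card_porbit_eq1 perm1.
  rewrite card_ord divn1 in ps.
  suff -> : cycle_lens (1%g : 'S_n) = nseq n 1%N by rewrite eqxx.
  rewrite (all_leq1_nseq (cycle_lens_gt0 (1%g : 'S_n))) (perm_size ps) size_nseq //.
  by rewrite sumn_lens.
rewrite (horner_cyc_quotient1 n0 (cycle_lens_gt0 _) (sumn_lens _) (eK Hh)).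
case: eqP => // e; case/eqP: h1; apply/permP => x; rewrite perm1; apply/eqP.
rewrite -card_porbit_eq1; have : #|porbit h x| \in cycle_lens h.
  by apply: map_f; rewrite mem_enum porbit_mem_porbits.
by rewrite e mem_nseq n0.
Qed.

Variables (t : 'S_n) (k r : nat) (w : F).
Let d := #[t]%g.
Hypotheses (d1 : (1 < d)%N) (wd : d.-primitive_root w) (r2 : (0 < r <= 2)%N).
Hypothesis lt : perm_eq (cycle_lens t) (nseq k d ++ nseq r 1%N).
Hypothesis en : n = (k * d + r)%N.
Hypothesis no_two : r = 2%N ->
  avoids H (nseq k d ++ [:: 2%N]).
Hypothesis no_four : r = 2%N -> d = 2%N -> (0 < k)%N ->
  avoids H (4%N :: nseq k.-1 2%N).

(** For [h] outside the class of [t] with nonzero value, [k] cycle lengths are divisible by [d]. If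
    the others sum to [r], they are all 1 and [h] is conjugate to [t], or a single 2, against
    [no_two]. Otherwise [r = d = 2], against [no_four]. *)
Lemma sum_quotients_at_prim :
  (\sum_(h in H) K h).[w] =
    (k`! * d ^ k * #|[set h in H | h \in (t ^: [set: 'S_n])%g]|)%N%:R.
Proof.
rewrite horner_sum (bigID (mem (t ^: [set: 'S_n])%g)) /= [X in _ + X]big1.
  rewrite addr0 mulnC natrM mulr_natl -sumr_const; apply: eq_big => [h|h /andP[Hh]].
    by rewrite inE.
  case/imsetP => g _ eh; apply: (horner_cyc_quotient_semiregular (s := cycle_lens h) wd d1 r2).
    by rewrite eh (perm_trans (cycle_lens_conj t g)) // lt.
  by rewrite -en eK.
move=> h /andP[Hh hnt]; have l0 := cycle_lens_gt0 h.
have [ck|] := eqVneq (count (dvdn d) (cycle_lens h)) (n.-1 %/ d)%N; last first.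
  exact: (horner_cyc_quotient_eq0 wd d1 l0 (eK Hh)).
exfalso; have {}ck : count (dvdn d) (cycle_lens h) = k.
  rewrite ck en (_ : (k * d + r).-1 = k * d + r.-1)%N; last by lia.
  by rewrite divnMDl ?(ltnW d1) // divn_small ?addn0 //; lia.
have rd : (0 < r <= d)%N by lia.
have conj : ~ perm_eq (cycle_lens h) (nseq k d ++ nseq r 1%N).
  move=> ps; case/negP: hnt; have [|g <-] := @cycle_lens_conjugate _ t h.
    by rewrite (perm_trans lt) // perm_sym.
  by apply: imset_f.
have [[srest efilt]|[er alld]] := count_dvdn_rem d1 rd l0 (etrans (sumn_lens h) en) ck.
  have ps : perm_eq (cycle_lens h)
      (nseq k d ++ filter (predC (dvdn d)) (cycle_lens h)).
    by rewrite -efilt perm_sym perm_filterC.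
  have l0' := all_filter_sub (predC (dvdn d)) l0.
  have [r1|rn1] := eqVneq r 1%N.
    apply: conj; rewrite r1 in srest *; rewrite (perm_trans ps) // perm_cat2l.
    move: srest l0'; case: [seq _ <- _ | _] => [|a [|b s]] //=.
      by rewrite addn0 => ->.
    by move=> e /and3P[a0 b0 _]; lia.
  have er2 : r = 2%N by lia.
  rewrite er2 in srest; case: (parts_of_two l0' srest) => e; rewrite e in ps.
    by have := no_two er2 Hh; rewrite /has_cycle_type ps.
  by apply: conj; rewrite er2.
(* The [k] cycle lengths are all even with sum [2 * k + 2]: one is 4, the others are 2. *)
have [er2 d2] : r = 2%N /\ d = 2%N by lia.
have szk : size (cycle_lens h) = k.
  rewrite -ck; apply/esym/eqP; rewrite -all_count; exact: alld.
have k0 : (0 < k)%N.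
  rewrite -szk lt0n; apply/eqP => /size0nil e; have := sumn_lens h; rewrite e /=.
  by move: n0; lia.
have := no_four er2 d2 k0 Hh; rewrite /has_cycle_type -/(cycle_lens h).
rewrite all_even_excess //; last by rewrite sumn_lens en; lia.
  by rewrite -d2.
by rewrite szk prednK.
Qed.

End Numerator.

(** By regularity all cycles of an element other than 1 have its order l as length, which is the
    avoided type (l^(n/l)). *)
Lemma long_cycle_conj_free (n : nat) (H : {group 'S_n}) :
    (forall l, (1 < l)%N -> (l %| n)%N -> avoids H (nseq (n %/ l) l)) ->
  forall c g : 'S_n, c \in <[long_cycle n]>%g -> (c ^ g)%g \in H -> c = 1%g.
Proof.
move=> Hi c g Cc cH; apply/eqP/negPn/negP => c1.
have [||ps dv] := @cycle_lens_const _ c #[c]%g.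
- exact: order_gt0.
- move=> x; apply: card_porbit_eq => i; rewrite order_dvdn.
  apply/eqP/eqP => [|->]; last by rewrite perm1.
  by apply/long_cycle_regular/groupX.
rewrite card_ord in ps dv.
have o1 : (1 < #[c]%g)%N by rewrite order_gt1.
have := Hi _ o1 dv _ cH.
by rewrite /has_cycle_type (perm_trans (cycle_lens_conj c g) ps).
Qed.

Lemma cyc_quotient_family (F : numFieldType) (n : nat) (z : F) (H : {group 'S_n}) :
    (0 < n)%N -> n.-primitive_root z ->
    (forall l, (1 < l)%N -> (l %| n)%N -> avoids H (nseq (n %/ l) l)) ->
  exists K : 'S_n -> {poly F}, forall h, h \in H ->
    K h * cyc_prod F (cycle_lens h) = (1 - 'X) * qpoch F n.-1.
Proof.
move=> n0 zn Hi.
apply: (fin_all_exists (P := fun h (K : {poly F}) => h \in H ->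
  K * cyc_prod F (cycle_lens h) = (1 - 'X) * qpoch F n.-1)) => h.
case: (boolP (h \in H)) => [Hh|]; last by exists 0.
have [||K eK] := @cyc_quotient_exists F n z (cycle_lens h) n0 zn (cycle_lens_gt0 h).
- by rewrite sumn_cycle_lens card_ord.
- by move=> l l1 ln; apply: (Hi l l1 ln h Hh).
by exists K.
Qed.

(** For [m = 1] the [q] parts [m] are fixed points as well, hence the restriction on the count. *)
Lemma semireg_of_cycle_lens (T : finType) (tau : {perm T}) m q r :
    perm_eq (cycle_lens tau) (nseq q m ++ nseq r 1%N) ->
  semireg tau /\ (m != 1%N -> #|fixpts tau| = r).
Proof.
move=> ps; have dich x : #|porbit tau x| = m \/ #|porbit tau x| = 1%N.
  have : #|porbit tau x| \in cycle_lens tau.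
    by apply: map_f; rewrite mem_enum porbit_mem_porbits.
  rewrite (perm_mem ps) mem_cat !mem_nseq.
  by case/orP => /andP[_ /eqP]; [left | right].
split; first exact: semireg_card_porbit dich.
move=> m1; rewrite fixpts_card_porbit count_cycle_lens mul1n (seq.permP ps).
by rewrite count_cat !count_nseq /= (negPf m1) mul0n mul1n.
Qed.

(** * Avoidance outside the class of t *)

Section NonClass.
Variables (n m : nat) (tau : 'S_n) (H : {group 'S_n}) (t : 'S_n).
Local Notation C := <[long_cycle n]>%G.
Hypothesis tN : t \in 'N(C)%g.
Hypotheses (st : semireg t) (t1 : t != 1%g) (dm : (#[t]%g %| m)%N).
Hypothesis r2 : (0 < #|fixpts t| <= 2)%N.
Hypothesis avoid_rect :
  forall l, (1 < l)%N -> (l %| n)%N -> avoids H (nseq (n %/ l) l).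
Hypothesis avoid_two :
  #|fixpts t| = 2%N -> forall l, (1 < l)%N -> (l %| m)%N -> (l %| n - 2)%N ->
     avoids H (nseq ((n - 2) %/ l) l ++ [:: 2%N]).
Hypothesis avoid_two_odd :
  #|fixpts t| = 2%N -> odd m ->
  forall l, (1 < l)%N -> (l %| m)%N -> (2 * l %| n - 2)%N ->
     avoids H (nseq ((n - 2) %/ (2 * l)) (2 * l)%N ++ [:: 2%N]).

(** With one fixed point the class of [t] is the whole coset. With two, [u] has type (l^(n/l)) if
    [t] is an involution, and otherwise ((2e)^k, 2) with [e] the order of [t ^+ 2]. The parities of
    [#[t]] and [m] decide which condition excludes the latter. *)
Lemma non_class_avoided u g :
  u \in (C :* t)%g -> u \notin (t ^: C)%g -> (u ^ g)%g \notin H.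
Proof.
move=> uC un; apply/negP => uH.
have /card_gt0P[p] : (0 < #|fixpts t|)%N by case/andP: r2.
rewrite inE => /eqP tp.
have abC : abelian C := cycle_abelian _.
have regC := @long_cycle_regular n; have transC := @long_cycle_trans n.
have cc := card_class_fixpts regC transC tN tp.
have type mu : avoids H mu -> perm_eq (cycle_lens u) mu -> False.
  move=> av ps; have := av _ uH.
  by rewrite /has_cycle_type (perm_trans (cycle_lens_conj u g) ps).
have [r1|rn1] := eqVneq #|fixpts t| 1%N.
  move: un; suff -> : (t ^: C)%g = (C :* t)%g by rewrite uC.
  apply/eqP; rewrite eqEcard class_sub_coset //= card_rcoset.
  by rewrite -cc r1 muln1.
have ct : #|fixpts t| = 2%N by move: r2 rn1; case: #|_| => [|[|[|i]]].
have [t2|t2] := eqVneq (t ^+ 2)%g 1%g.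
  have [l [l1 ln ps]] := non_class_cycle_lens_involution abC regC transC tN tp ct t2 uC un.
  by rewrite card_ord in ln ps; apply: (type _ (avoid_rect l1 ln)).
have [k [ps en]] := non_class_cycle_lens abC regC transC tN tp ct st t2 uC un.
rewrite card_ord in en; set e := #[_]%g in ps en.
have en2 : (n - 2 = k * (2 * e))%N by rewrite [X in (X - 2)%N]en addnK.
have e1 : (1 < e)%N by rewrite order_gt1.
have ee : e = (#[t]%g %/ gcdn #[t]%g 2)%N by rewrite /e orderXgcd.
have q2 l : (1 < l)%N -> l = (2 * e)%N -> ((n - 2) %/ l = k)%N /\ (l %| n - 2)%N.
  by move=> l1 ->; rewrite en2 dvdn_mull // mulnK // muln_gt0 order_gt0.
(* For even [#[t]], [2 * e] is [#[t]] itself, a divisor of [m]. *)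
have [ev|od] := boolP (2 %| #[t]%g)%N.
  have el : #[t]%g = (2 * e)%N.
    by rewrite ee (gcdn_idPr ev) mulnC divnK.
  have l1 : (1 < #[t]%g)%N by rewrite order_gt1.
  have [q3 dv] := q2 _ l1 el.
  apply: (type _ (avoid_two ct l1 dm dv)).
  by rewrite q3 el.
have el : e = #[t]%g.
  have cop : coprime #[t]%g 2 by rewrite coprimen2; move: od; rewrite dvdn2 negbK.
  by rewrite ee (eqP cop) divn1.
have l1 : (1 < 2 * e)%N by rewrite (leq_trans e1) // leq_pmull.
have [q3 dv] := q2 _ l1 erefl.
(* Now [e = #[t]] is odd. For odd [m] the condition with parts [2 * l] is used at [l = e]; for even
   [m], already [2 * e] divides [m]. *)
have [om|em] := boolP (odd m).
  apply: (type _ (avoid_two_odd ct om e1 _ dv)); first by rewrite el.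
  by rewrite q3.
apply: (type _ (avoid_two ct l1 _ dv)); last by rewrite q3.
rewrite Gauss_dvd ?dvdn2 ?em ?el //.
by rewrite coprime2n; move: od; rewrite dvdn2 negbK.
Qed.

End NonClass.

Theorem theorem3p2 (R : realType) (n m : nat) (tau : 'S_n) (H : {group 'S_n}) :
  (3 <= n)%N ->
  tau \in 'N(<[long_cycle n]>)%g ->
  (0 < m)%N ->
  ((m %| n - 1)%N /\ has_cycle_type (nseq ((n - 1) %/ m) m ++ [:: 1%N]) tau) \/
  ((m %| n - 2)%N /\
     has_cycle_type (nseq ((n - 2) %/ m) m ++ [:: 1%N; 1%N]) tau) ->
  (forall l, (1 < l)%N -> (l %| n)%N -> avoids H (nseq (n %/ l) l)) ->
  (~~ odd m -> (4 <= n)%N -> (2 %| n - 4)%N ->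
     avoids H (4%N :: nseq ((n - 4) %/ 2) 2%N)) ->
  (forall l, (1 < l)%N -> (l %| m)%N -> (l %| n - 2)%N ->
     avoids H (nseq ((n - 2) %/ l) l ++ [:: 2%N])) ->
  (odd m -> forall l, (1 < l)%N -> (l %| m)%N -> (2 * l %| n - 2)%N ->
     avoids H (nseq ((n - 2) %/ (2 * l)) (2 * l)%N ++ [:: 2%N])) ->
  exists X Y : {poly int},
    [/\ fps_mul (fps_poly X) (hilbert_series R[i] [set: 'S_n]) =1
          hilbert_series R[i] H,
        qnum n * Y = X
      & cyclic_sieving R (lmul_act tau)
          (double_cosets <[long_cycle n]>%g H) Y].
Proof.
move=> n3 tauN m0 tau_type avoid_rect avoid_four avoid_two avoid_two_odd.
have n0 : (0 < n)%N by apply: leq_trans n3.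
(* Both admissible types are treated together, [r] being the number of trailing parts 1. *)
have [q [r [r2 ps]]] : exists q r, (0 < r <= 2)%N /\
    perm_eq (cycle_lens tau) (nseq q m ++ nseq r 1%N).
  by case: tau_type => [[_ ps]|[_ ps]]; [exists ((n - 1) %/ m)%N, 1%N | exists ((n - 2) %/ m)%N, 2%N].
have [stau ctau] := semireg_of_cycle_lens ps.
have free := long_cycle_conj_free avoid_rect.
have [K eK] := cyc_quotient_family n0 (zeta_prim R n0) avoid_rect.
(* [Q] is (q; q)_n divided by [n]_q, so that the numerator obtained from it is X(q) divided by
   [n]_q. *)
pose Q : {poly int} := (1 - 'X) * qpoch int n.-1.
have [Y [eY HY]] : exists Y : {poly int},
    fps_mul (fps_poly Q) (hilbert_series R[i] H) =1 fps_poly Y /\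
    #|H|%:R *: map_poly intr Y = \sum_(h in H) K h.
  apply: hilbert_numerator => h Hh; rewrite -/(cycle_lens h) eK // /Q.
  by rewrite rmorphM rmorphB rmorph1 /= map_polyX map_cyc_prod.
exists (qnum n * Y), Y; split=> //.
  apply: hilbert_quotient eY.
  by rewrite /Q mulrA [_ * (1 - 'X)]mulrC -onemXn_factor -[in RHS](prednK n0) qpochS prednK.
split; first exact: lmul_acts_double_cosets.
move=> b; have [k0 [-> ->]] := expgz_zeta R tau b.
set t := (tau ^+ k0)%g; set w := zeta R _ ^+ k0.
have tt : t \in <[tau]>%g by apply: mem_cycle.
have tN : t \in 'N(<[long_cycle n]>)%g by apply: groupX.
have wd : #[t]%g.-primitive_root w.
  by rewrite orderXgcd gcdnC; apply/exp_prim_root/zeta_prim/order_gt0.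
have H0 : #|H|%:R != 0 :> R[i] by rewrite Num.Theory.pnatr_eq0 -lt0n cardG_gt0.
apply: (mulfI H0); rewrite -hornerZ HY -natrM.
have regC := @long_cycle_regular n; have transC := @long_cycle_trans n.
have [t1|t1] := eqVneq t 1%g.
  have -> : w = 1 by move: wd; rewrite t1 order1 => /prim_expr_order.
  rewrite (sum_quotients_at1 n0 eK); congr _%:R.
  have := card_fix_double_cosets_1 free tauN tt t1.
  rewrite (card_regular regC transC (Ordinal n0)) card_ord -mulnA.
  have -> : (n`! = n * (n.-1)`!)%N by rewrite -{1}(prednK n0) factS prednK.
  by move/eqP; rewrite eqn_pmul2l // => /eqP.
have d1 : (1 < #[t]%g)%N by rewrite order_gt1.
have tau1 : tau != 1%g by apply: contraNneq t1 => e; rewrite /t e expg1n.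
have om : #[tau]%g = m.
  have [x tx] : exists x, tau x != x.
    apply/existsP; apply: contraNT tau1; rewrite negb_exists => /forallP e.
    by apply/eqP/permP => x; rewrite perm1; apply/eqP; rewrite -[_ == _]negbK.
  have : #|porbit tau x| \in cycle_lens tau.
    by apply: map_f; rewrite mem_enum porbit_mem_porbits.
  rewrite (perm_mem ps) mem_cat !mem_nseq card_porbit_eq1 (negPf tx) andbF orbF.
  by rewrite (card_porbit_semireg stau tx) => /andP[_ /eqP].
have dm : (#[t]%g %| m)%N by rewrite -om orderXdvd.
(* A nontrivial power of [tau] rules out [m = 1], so [tau] has exactly [r] fixed points. *)
have m1 : m != 1%N by apply/eqP => em; move: dm; rewrite em dvdn1 gtn_eqF.
have st : semireg t by apply: semiregX.
have ct : #|fixpts t| = r by rewrite fixptsX // ctau.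
have [k [pst en]] := cycle_lens_semireg st t1 ct.
rewrite card_ord in en.
(* As [#[t]] divides [m] and [n - 2], the condition on (l^((n-2)/l), 2) applies with [l = #[t]]. *)
have no_two : r = 2%N -> avoids H (nseq k #[t]%g ++ [:: 2%N]).
  move=> er; have en2 : (n - 2 = k * #[t]%g)%N by rewrite [X in (X - 2)%N]en er addnK.
  have := avoid_two _ d1 dm; rewrite en2 dvdn_mull // mulnK ?order_gt0 //.
  exact.
(* A power of order 2 makes [m] even, and [n = k * 2 + 2] gives [n - 4 = k.-1 * 2]. *)
have no_four : r = 2%N -> #[t]%g = 2%N -> (0 < k)%N ->
    avoids H (4%N :: nseq k.-1 2%N).
  move=> er ed kp; rewrite er ed in en; rewrite ed in dm.
  have en4 : (n - 4 = k.-1 * 2)%N by clear - en kp; lia.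
  have n4 : (3 < n)%N by clear - en kp; lia.
  by have := avoid_four; rewrite -dvdn2 dm n4 en4 dvdn_mull // mulnK //; apply.
rewrite (sum_quotients_at_prim n0 eK d1 wd r2 pst en no_two no_four).
congr _%:R.
have abC := cycle_abelian (long_cycle n).
have := card_fix_double_cosets_semireg (k := k) abC regC transC free tauN tt st t1 ct r2.
rewrite card_ord => /(_ en); apply=> u g.
by apply: (non_class_avoided (m := m)); rewrite ?ct.
Qed.
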